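(* The Bethe subalgebra $\mathcal{B}^S_{n,\hbar}(z_1,\dots,z_n)$ tends to the Gelfand–Zetlin subalgebra $\mathcal{G}_n\subset\mathbb{C}[\mathfrak{S}_n]$ as $\hbar/(z_1-z_2)\to0$ and $(z_{a-1}-z_a)/(z_a-z_{a+1})\to0$ for $a=2,\dots,n-1$.
   Context: $\mathfrak{S}_n$ is the symmetric group; $\sigma_{a,b}$ is the transposition of $a$ and $b$; permutations are multiplied as functions (right factor acts first). $A^{[m]}=\frac1{m!}\sum_{\sigma\in\mathfrak{S}_m}\mathrm{sign}(\sigma)\,\sigma$. We view $\mathfrak{S}_n\subset\mathfrak{S}_{n+m}$ as the permutations fixing $n+1,\dots,n+m$, and $\vartheta_m:\mathbb{C}[\mathfrak{S}_m]\to\mathbb{C}[\mathfrak{S}_{n+m}]$ is the embedding induced by $i\mapsto n+i$. For $p\in\mathbb{C}$ the linear map $\mathrm{Tr}^{(p)}_m:\mathbb{C}[\mathfrak{S}_{n+m}]\to\mathbb{C}[\mathfrak{S}_n]$ is defined as follows: for $\sigma\in\mathfrak{S}_{n+m}$ written as a product of disjoint cycles, delete all symbols $>n$ and read the result as $\tau\in\mathfrak{S}_n$; let $c(\sigma)$, $c(\tau)$ be the numbers of orbits of $\sigma$ on $\{1,\dots,n+m\}$ and of $\tau$ on $\{1,\dots,n\}$; then $\mathrm{Tr}^{(p)}_m(\sigma)=p^{c(\sigma)-c(\tau)}\tau$ (with $p^0=1$). It is applied coefficientwise to polynomials in $u$. For $z_1,\dots,z_n\in\mathbb{C}$, $\hbar\in\mathbb{C}\setminus\{0\}$,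 $m\ge1$, put $$T^{[n]}_m(u;p;\hbar)=\mathrm{Tr}^{(p)}_m\Bigl(\vartheta_m(A^{[m]})\bigl(u-z_n+\hbar\sum_{i=1}^m\sigma_{n,n+i}\bigr)\cdots\bigl(u-z_1+\hbar\sum_{i=1}^m\sigma_{1,n+i}\bigr)\Bigr)=\sum_{i=0}^nT^{[n]}_{m,i}(p;\hbar)u^{n-i}.$$ $\mathcal{B}^S_{n,\hbar}(z_1,\dots,z_n)$ is the unital subalgebra of $\mathbb{C}[\mathfrak{S}_n]$ generated by all $T^{[n]}_{m,i}(p;\hbar)$, $m=1,\dots,n-1$, $i=1,\dots,n$, for a given $p$; it does not depend on $p$. $\mathcal{G}_n$ is the subalgebra of $\mathbb{C}[\mathfrak{S}_n]$ generated by the centers of $\mathbb{C}[\mathfrak{S}_m]$, $m=1,\dots,n$, where $\mathbb{C}[\mathfrak{S}_m]\subset\mathbb{C}[\mathfrak{S}_n]$ is induced by $i\mapsto i$. ''Tends to'' means convergence of linear subspaces of $\mathbb{C}[\mathfrak{S}_n]$: along any sequence of parameters $(\hbar,z_1,\dots,z_n)$, $\hbar\ne0$, satisfying the limit conditions, the subspaces $\mathcal{B}^S_{n,\hbar}(z_1,\dots,z_n)$ eventually have dimension $\dim\mathcal{G}_n$ and converge to $\mathcal{G}_n$ in the Grassmannian. *)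

(* Defs.v *)
From HB Require Import structures.
From mathcomp Require Import all_boot all_order all_algebra all_fingroup all_field.
From mathcomp Require Import all_classical all_reals all_analysis.
From mathcomp Require Import complex.

Set Implicit Arguments.
Unset Strict Implicit.
Unset Printing Implicit Defensive.

Import Order.TTheory GRing.Theory Num.Theory.
Import numFieldNormedType.Exports.

Local Open Scope classical_set_scope.
Local Open Scope ring_scope.

(** The group algebra F[S_n], with 'S_n acting on {0, ..., n-1}.  It is an
    alias of {ffun 'S_n -> F^o} because the latter may carry the pointwise
    ring structure.  In MathComp (s * t)%g applies s first; the product below
    is e_s * e_t = e_(s o t) = e_(t * s)%g, where the right factor acts first. *)
Definition symalg (F : fieldType) (n : nat) := {ffun 'S_n -> F^o}.

HB.instance Definition _ (F : fieldType) (n : nat) :=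
  Vector.copy (symalg F n) {ffun 'S_n -> F^o}.

Section SymAlg.
Variables (F : fieldType) (n : nat).
Implicit Types (x y z : symalg F n) (s t : 'S_n).

Definition symb (s : 'S_n) : symalg F n := [ffun t => (t == s)%:R].

Definition symalg_mul (x y : symalg F n) : symalg F n :=
  \sum_(s : 'S_n) \sum_(t : 'S_n) (x s * y t) *: symb (t * s)%g.

Lemma symalg_mulE x y u :
  symalg_mul x y u = \sum_(s : 'S_n) x s * y (u * s^-1)%g.
Proof.
rewrite /symalg_mul sum_ffunE; apply: eq_bigr => s _.
rewrite sum_ffunE (bigD1 (u * s^-1)%g) //= big1 => [|t tN].
  by rewrite !ffunE mulgKV eqxx addr0 /GRing.scale/= mulr1.
rewrite !ffunE (_ : (_ == _) = false) ?scaler0//.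
by apply: contraNF tN => /eqP ->; rewrite mulgK.
Qed.

Lemma symalg_mulA : associative symalg_mul.
Proof.
move=> x y z; apply/ffunP => u; rewrite !symalg_mulE.
under eq_bigr => s _ do rewrite symalg_mulE big_distrr/=.
under [RHS]eq_bigr => s _ do rewrite symalg_mulE big_distrl/=.
rewrite [RHS]exchange_big/=; apply: eq_bigr => s _.
rewrite (reindex_inj (mulIg s^-1%g))/=; apply: eq_bigr => t _.
by rewrite mulrA; congr (_ * z _); rewrite invMg invgK mulgA mulgKV.
Qed.

Lemma symalg_mul1l : left_id (symb 1%g) symalg_mul.
Proof.
move=> x; apply/ffunP => u; rewrite symalg_mulE (bigD1 1%g)//= big1 => [|s sN].
  by rewrite ffunE eqxx mul1r invg1 mulg1 addr0.
by rewrite ffunE (negPf sN) mul0r.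
Qed.

Lemma symalg_mul1r : right_id (symb 1%g) symalg_mul.
Proof.
move=> x; apply/ffunP => u; rewrite symalg_mulE (bigD1 u)//= big1 => [|s sN].
  by rewrite ffunE mulgV eqxx mulr1 addr0.
rewrite ffunE (_ : (_ == _) = false) ?mulr0//.
by apply: contraNF sN; rewrite -eq_mulgV1 eq_sym.
Qed.

Lemma symalg_mulDl : left_distributive symalg_mul +%R.
Proof.
move=> x y z; apply/ffunP => u; rewrite !ffunE !symalg_mulE -big_split/=.
by apply: eq_bigr => s _; rewrite !ffunE mulrDl.
Qed.

Lemma symalg_mulDr : right_distributive symalg_mul +%R.
Proof.
move=> x y z; apply/ffunP => u; rewrite !ffunE !symalg_mulE -big_split/=.
by apply: eq_bigr => s _; rewrite !ffunE mulrDr.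
Qed.

Lemma symb1_neq0 : symb 1%g != 0.
Proof.
by apply/eqP => /ffunP/(_ 1%g)/eqP; rewrite !ffunE eqxx oner_eq0.
Qed.

HB.instance Definition _ := GRing.Zmodule_isNzRing.Build (symalg F n)
  symalg_mulA symalg_mul1l symalg_mul1r symalg_mulDl symalg_mulDr symb1_neq0.

Lemma symalg_scalerAl (a : F) x y : a *: (x * y) = (a *: x) * y.
Proof.
apply/ffunP => u; rewrite ffunE [in LHS]symalg_mulE [in RHS]symalg_mulE.
rewrite scaler_sumr; apply: eq_bigr => s _; rewrite !ffunE.
by rewrite /GRing.scale/= mulrA.
Qed.

HB.instance Definition _ :=
  GRing.Lmodule_isLalgebra.Build F (symalg F n) symalg_scalerAl.

Lemma symalg_scalerAr (a : F) x y : a *: (x * y) = x * (a *: y).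
Proof.
apply/ffunP => u; rewrite ffunE [in LHS]symalg_mulE [in RHS]symalg_mulE.
rewrite scaler_sumr; apply: eq_bigr => s _; rewrite !ffunE.
by rewrite /GRing.scale/= mulrCA.
Qed.

HB.instance Definition _ :=
  GRing.Lalgebra_isAlgebra.Build F (symalg F n) symalg_scalerAr.
HB.instance Definition _ := Algebra_isFalgebra.Build F (symalg F n).

End SymAlg.

(** The permutation of {0, ..., n+m-1} acting as s on the last m points. *)
Section Shift.
Variables (n m : nat).

Definition shift_fun (s : 'S_m) (i : 'I_(n + m)) : 'I_(n + m) :=
  match fintype.split i with
  | inl j => lshift m j
  | inr k => rshift n (s k)
  end.

Lemma shift_fun_inj (s : 'S_m) : injective (shift_fun s).
Proof.
move=> i j; rewrite /shift_fun.
case: (split_ordP i) => i' ->; case: (split_ordP j) => j' ->.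
- by move=> /lshift_inj ->.
- by move=> /eqP; rewrite eq_lrshift.
- by move=> /eqP; rewrite eq_rlshift.
- by move=> /rshift_inj/perm_inj ->.
Qed.

Definition shift_perm (s : 'S_m) : 'S_(n + m) := perm (@shift_fun_inj s).

End Shift.

(** Deleting the symbols >= n from the cycles of s : 'S_(n + m): the image of
    i < n is the first of s i, s (s i), ... that is < n. *)
Section Restrict.
Variables (n m : nat).
Implicit Types (s : 'S_(n + m)) (i : 'I_n).

Lemma return_subproof s i :
  exists k, (iter k.+1 s (lshift m i) < n)%N.
Proof.
exists #[s]%g.-1; rewrite prednK ?order_gt0//.
by rewrite -permX expg_order perm1 /=.
Qed.

Definition return_time s i : nat := (ex_minn (return_subproof s i)).+1.

Lemma return_timeP s i : (iter (return_time s i) s (lshift m i) < n)%N.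
Proof. by rewrite /return_time; case: ex_minnP. Qed.

Definition return_fun s i : 'I_n := Ordinal (return_timeP s i).

Lemma return_fun_inj s : injective (return_fun s).
Proof.
move=> i j.
wlog le_ij : i j / (return_time s i <= return_time s j)%N.
  move=> W e; case/orP: (leq_total (return_time s i) (return_time s j)) => h.
    exact: W.
  by apply/esym/W.
move=> /(congr1 val) h.
have {h} : iter (return_time s i) s (lshift m i)
         = iter (return_time s j) s (lshift m j) by apply: val_inj.
rewrite -{1}(subnKC le_ij) iterD => e.
have {e} : lshift m i
         = iter (return_time s j - return_time s i) s (lshift m j).
  by elim: {1 2}(return_time s i) e => [//|c IH] /= /perm_inj.
case E: (return_time s j - return_time s i)%N => [|k] e; first exact: lshift_inj e.
have : (iter k.+1 s (lshift m j) < n)%N by rewrite -e /=.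
move: E; rewrite /return_time; case: (ex_minnP (return_subproof s j)) => b _ hb.
move=> E hk; have := hb _ hk; rewrite leqNgt => /negP[].
by rewrite -ltnS -E subSS; apply: leq_ltn_trans (leq_subr _ _) _.
Qed.

Definition del_perm s : 'S_n := perm (@return_fun_inj s).

End Restrict.

Section Bethe.
Variable F : fieldType.

Definition symalg_shift (n m : nat) (x : symalg F m) : symalg F (n + m) :=
  \sum_(s : 'S_m) x s *: symb F (shift_perm n s).

Definition antisym (m : nat) : symalg F m :=
  (m`!%:R)^-1 *: \sum_(s : 'S_m) (-1) ^+ odd_perm s *: symb F s.

(** The natural-number subtraction is exact: every orbit of del_perm s is the
    trace of an orbit of s. *)
Definition Tr (n m : nat) (p : F) (x : symalg F (n + m)) : symalg F n :=
  \sum_(s : 'S_(n + m))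
    (x s * p ^+ (#|porbits s| - #|porbits (del_perm s)|)) *: symb F (del_perm s).

Definition bethe_factor (n m : nat) (hbar : F) (z : 'I_n -> F) (a : 'I_n) :
    {poly symalg F (n + m)} :=
  'X - ((z a)%:A)%:P
  + (hbar *: \sum_(i < m) symb F (tperm (lshift m a) (rshift n i)))%:P.

Definition betheT (n m : nat) (p hbar : F) (z : 'I_n -> F) :
    {poly symalg F n} :=
  map_poly (@Tr n m p)
    ((symalg_shift n (antisym m))%:P
     * \prod_(a < n) bethe_factor m hbar z (rev_ord a)).

Definition bethe_coef (n m i : nat) (p hbar : F) (z : 'I_n -> F) : symalg F n :=
  (betheT m p hbar z)`_(n - i).

Definition bethe_alg (n : nat) (p hbar : F) (z : 'I_n -> F) :
    {aspace symalg F n} :=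
  << <<[seq bethe_coef m i p hbar z | m <- iota 1 n.-1, i <- iota 1 n]>> >>%AS.

(** F[S_m] inside F[S_n], for m <= n. *)
Definition sub_symalg (n m : nat) : {vspace symalg F n} :=
  <<[seq symb F s | s <- enum (Sym [set i : 'I_n | (i < m)%N]%SET)]>>%VS.

Definition gelfand_zetlin (n : nat) : {aspace symalg F n} :=
  << \sum_(m < n) 'Z(sub_symalg n m.+1) >>%AS.

End Bethe.

(** The disjoint union, over all d, of the Grassmannians of d-dimensional
    subspaces of V, each with the quotient topology from the space of d-frames.
    Frames are written as matrices of coordinates in a fixed basis of V.
    A sequence of subspaces converges to W here iff its dimension is eventually
    \dim W and it converges to W in the Grassmannian of that dimension. *)
Definition grassmannian (K : numFieldType) (V : vectType K) := {vspace V}.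

HB.instance Definition _ (K : numFieldType) (V : vectType K) :=
  Choice.copy (grassmannian V) {vspace V}.

Section Grassmannian.
Variables (K : numFieldType) (V : vectType K).

Definition row_span (d : nat) (M : 'M[K]_(d, \dim {:V})) : grassmannian V :=
  <<[seq passmx.vecof (vbasis {:V}) (row i M) | i <- enum 'I_d]>>%VS.

Definition frames (d : nat) : set 'M[K]_(d, \dim {:V}) := [set M | row_free M].

Definition grass_open (O : set (grassmannian V)) : Prop :=
  forall d : nat, open (@row_span d @^-1` O : set (subspace (@frames d))).

Lemma grass_openT : grass_open setT.
Proof. by move=> d; rewrite preimage_setT; exact: openT. Qed.

Lemma grass_openI : setI_closed grass_open.
Proof. by move=> A B oA oB d; rewrite preimage_setI; exact: openI. Qed.

Lemma grass_open_bigU (I : Type) (f : I -> set (grassmannian V)) :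
  (forall i, grass_open (f i)) -> grass_open (\bigcup_i f i).
Proof.
by move=> of_ d; rewrite preimage_bigcup; apply: bigcup_open => i _; exact: of_.
Qed.

HB.instance Definition _ := isOpenTopological.Build (grassmannian V)
  grass_openT grass_openI grass_open_bigU.

End Grassmannian.

(* Main.v *)
Require Import Defs.
From HB Require Import structures.
From mathcomp Require Import all_boot all_order all_algebra all_fingroup all_field.
From mathcomp Require Import all_classical all_reals all_analysis.
From mathcomp Require Import complex zify ring.
Import Order.TTheory GRing.Theory Num.Theory.
Import numFieldNormedType.Exports.
Local Open Scope classical_set_scope.
Local Open Scope ring_scope.

Set Implicit Arguments.
Unset Strict Implicit.
Unset Printing Implicit Defensive.

(** Why the theorem is true.  At [u = z a] the factor of [T_1(u)] at the site [a]
    reduces to a transposition with the single auxiliary point, and the trace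
    collapses: [T_1(z a)] is [hbar] times the product [hamiltonian a] of the
    factors [z a - z b + hbar * (b a)] over [b != a].  When the gaps of [z] grow
    fast, [hbar / (z a - z b)] is equivalent to [d = hbar / (z a - z (a-1))] for
    [b < a] and negligible with respect to [d] for [b > a].  The normalized
    Hamiltonian is therefore [1 + d * J_a] up to terms negligible with respect
    to [d], where [J_a] is the Jucys-Murphy element, the sum of the
    transpositions [(b a)] with [b < a].  So elements [x_a] of the Bethe
    subalgebra converge to [J_a] ([rescaled_ham_lim]).

    The Jucys-Murphy elements generate the Gelfand-Zetlin algebra, which equals
    its own centraliser ([gelfand_zetlin_jm], [centraliser_jm]).  Hence every
    element of the Gelfand-Zetlin algebra is a limit of elements of the Bethe
    subalgebras, whose dimensions are eventually at least that of the limit.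
    For the converse bound it suffices that the Bethe subalgebra commutes with
    the Hamiltonians: it is then contained in the commutant of the [x_a], whose
    dimension near the limit is at most that of the commutant of the [J_a]
    ([near_dim_le]).

    Commutation with the Hamiltonians ([ham_comm_trace]) is an exchange argument.
    The factors of the transfer matrix satisfy a Yang-Baxter relation ([rtt]);
    multiplication by the Hamiltonian at [a] carries the factor at [a] once
    around the product.  The rotation is invisible to the trace because a site
    may be inserted in a cycle on either side of a symbol to be deleted
    ([del_perm_swap]).

    Maximal commutativity is proved by adding one point at a time.  Let [J] be
    generated by the Jucys-Murphy elements of the group algebra of the first [m]
    points.  An element that commutes with [J] is a combination of products of
    elements of [J] with elements that commute with the whole group algebra of
    the [m] points ([centraliser_peel]): this is an orthogonality argument that
    uses only averages over the symmetric group.  Inside the group algebra of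
    [m + 1] points, the latter elements are averages of permutations, and they
    are polynomials in the next Jucys-Murphy element over the centre, because
    multiplication by that element lengthens the cycle of the new point
    ([avg_in_jm]). *)

(** * The group basis of the algebra *)

Section GroupBasis.
Variables (F : fieldType) (n : nat).
Implicit Types (s t : 'S_n) (x y : symalg F n).

Lemma symbM s t : symb F s * symb F t = symb F (t * s)%g.
Proof.
apply/ffunP => u; rewrite symalg_mulE (bigD1 s) //= big1 => [|r rs].
  by rewrite !ffunE eqxx mul1r addr0 eq_mulgV1 -mulgA -invMg -eq_mulgV1.
by rewrite !ffunE (negPf rs) mul0r.
Qed.

Lemma symalg_sum x : x = \sum_s x s *: symb F s.
Proof.
apply/ffunP => u; rewrite sum_ffunE (bigD1 u) //= big1 => [|r rs].
  by rewrite !ffunE eqxx addr0 /GRing.scale/= mulr1.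
by rewrite !ffunE eq_sym (negPf rs) scaler0.
Qed.

Lemma symb1 : symb F (1%g : 'S_n) = 1. Proof. by []. Qed.

Lemma mul_coefE x y s : (x * y) s = \sum_g x g * y (s * g^-1)%g.
Proof. exact: symalg_mulE. Qed.

Lemma mul_coefE_inv x y s : (x * y) s = \sum_h x (h^-1 * s)%g * y h.
Proof.
rewrite mul_coefE (reindex_inj (inj_comp (mulIg s) invg_inj)) /=.
by apply: eq_bigr => h _; rewrite invMg invgK mulgA mulgV mul1g.
Qed.

End GroupBasis.

(** * Deleting symbols from cycles *)

Section Deletion.
Variables n m : nat.
Implicit Types (s t : 'S_(n + m)) (x : 'I_(n + m)) (i j a b : 'I_n).

(** The first return to the sites, as an inductive relation: facts about
    [del_perm] then follow by induction along the trajectory, without computing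
    with minimal return times. *)
Inductive next_site s x j : Prop :=
| next_site_stop : s x = lshift m j -> next_site s x j
| next_site_step (i : 'I_m) :
    s x = rshift n i -> next_site s (rshift n i) j -> next_site s x j.

Lemma next_site_fun s x j j' : next_site s x j -> next_site s x j' -> j = j'.
Proof.
move=> h; elim: h j' => {x j} [x j sx|x j i sx _ IH] j' [sx'|i' sx' h'].
- by apply: (@lshift_inj _ m); rewrite -sx.
- by move: sx'; rewrite sx => /eqP; rewrite eq_lrshift.
- by move: sx'; rewrite sx => /eqP; rewrite eq_rlshift.
- by apply: IH; move: sx'; rewrite sx => /rshift_inj ->.
Qed.

Lemma del_perm_next s i : next_site s (lshift m i) (del_perm s i).
Proof.
rewrite permE /return_fun.
move: (return_timeP s i); rewrite /return_time; case: ex_minnP => k.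
move: (lshift m i) => x kn kmin le_k.
have {kmin} kmin l : (l < k)%N -> (n <= iter l.+1 s x)%N.
  by move=> lk; rewrite leqNgt; apply/negP => /kmin; rewrite leqNgt lk.
elim: k x {kn} kmin le_k => [|k IH] x kmin le_k.
  by apply: next_site_stop; apply: val_inj.
have := kmin 0%N isT; rewrite /=.
case: (split_ordP (s x)) => y sx; rewrite sx /= => n_le.
  by move: n_le; rewrite leqNgt ltn_ord.
apply: (next_site_step sx); rewrite -sx.
have E l : iter l s (s x) = iter l.+1 s x by rewrite -iterSr.
have h : (iter k.+1 s (s x) < n)%N by rewrite E.
rewrite (_ : Ordinal le_k = Ordinal h); last by apply: val_inj; rewrite /= -iterSr.
by apply: IH => l lk; rewrite E; apply: kmin.
Qed.

Lemma del_permP s i j : next_site s (lshift m i) j -> del_perm s i = j.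
Proof. by apply: next_site_fun; apply: del_perm_next. Qed.

Lemma tpermL_lshift a b i :
  tperm (lshift m a) (lshift m b) (lshift m i) = lshift m (tperm a b i).
Proof. by rewrite (@inj_tperm _ _ (@lshift n m)) //; exact: lshift_inj. Qed.

Lemma tpermL_rshift a b (i : 'I_m) :
  tperm (lshift m a) (lshift m b) (rshift n i) = rshift n i.
Proof. by rewrite tpermD // eq_lrshift. Qed.

Lemma del_perm_mulr_tperm s a b :
  del_perm (s * tperm (lshift m a) (lshift m b)) = (del_perm s * tperm a b)%g.
Proof.
apply/permP => i; rewrite permM; apply: del_permP.
elim: (del_perm_next s i) => {i} [x j|x j i].
  by move=> sx; apply: next_site_stop; rewrite permM sx tpermL_lshift.
by move=> sx _; apply: next_site_step; rewrite permM sx tpermL_rshift.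
Qed.

Lemma del_perm_mull_tperm s a b :
  del_perm (tperm (lshift m a) (lshift m b) * s) = (tperm a b * del_perm s)%g.
Proof.
apply/permP => i; rewrite permM; apply: del_permP.
have := del_perm_next s (tperm a b i); rewrite -tpermL_lshift.
move: (lshift m i) (del_perm s _) => x j; set t := tperm _ _.
move=> h; move: (erefl (t x)) h; move: {-2}(t x) => y E h.
elim: h x E => {y j} [y j sy|y j k sy _ IH] x E.
  by apply: next_site_stop; rewrite permM -E.
apply: (@next_site_step _ _ _ k); first by rewrite permM -E.
by apply: IH; rewrite tpermL_rshift.
Qed.

(** Inserting the symbol [a] just before or just after [n + i] in its cycle
    makes no difference once [n + i] is deleted. *)
Lemma del_perm_swap s a (i : 'I_m) : s (lshift m a) = lshift m a ->
  del_perm (s * tperm (lshift m a) (rshift n i)) =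
  del_perm (tperm (lshift m a) (rshift n i) * s).
Proof.
set t := tperm _ _ => sa.
(* Away from [a] and [n + i] both permutations follow [s] up to a visit to
   [n + i], where both stop at [a]. *)
have away x j : next_site (s * t) x j -> x != lshift m a -> x != rshift n i ->
    next_site (t * s) x j.
  elim=> {x j} [x j|x j i'].
    move=> stx xa xi; move: stx; rewrite permM.
    case: (eqVneq (s x) (rshift n i)) => sx.
      rewrite sx /t tpermR => /lshift_inj <-.
      apply: (@next_site_step _ _ _ i); first by rewrite permM tpermD 1?eq_sym.
      by apply: next_site_stop; rewrite permM tpermR.
    have sxa : s x != lshift m a by rewrite -sa (inj_eq perm_inj).
    rewrite /t tpermD 1?eq_sym // => sxj; apply: next_site_stop.
    by rewrite permM tpermD 1?eq_sym.
  rewrite permM => stx _ IH xa xi; case: (eqVneq (s x) (rshift n i)) => sx.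
    by move: stx; rewrite sx /t tpermR => /eqP; rewrite eq_lrshift.
  have sxa : s x != lshift m a by rewrite -sa (inj_eq perm_inj).
  move: stx; rewrite /t tpermD 1?eq_sym // => sxi'.
  apply: (@next_site_step _ _ _ i'); first by rewrite permM tpermD 1?eq_sym.
  by apply: IH; rewrite -?sxi' // sxi' eq_rlshift.
(* The trajectory of [a] under [t * s] is that of [n + i] under [s * t]. *)
have from_i j : next_site (s * t) (rshift n i) j -> next_site (t * s) (lshift m a) j.
  have sia : s (rshift n i) != lshift m a.
    by rewrite -sa (inj_eq perm_inj) eq_rlshift.
  case=> [|i']; rewrite permM.
    case: (eqVneq (s (rshift n i)) (rshift n i)) => si.
      rewrite si /t tpermR => /lshift_inj <-.
      apply: (@next_site_step _ _ _ i); first by rewrite permM tpermL.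
      by apply: next_site_stop; rewrite permM tpermR.
    rewrite /t tpermD 1?eq_sym // => sij.
    by apply: next_site_stop; rewrite permM tpermL.
  case: (eqVneq (s (rshift n i)) (rshift n i)) => si.
    by rewrite si /t tpermR => /eqP; rewrite eq_lrshift.
  rewrite /t tpermD 1?eq_sym // => sij h.
  apply: (@next_site_step _ _ _ i'); first by rewrite permM tpermL.
  by apply: (away _ _ h); rewrite ?eq_rlshift // -sij.
apply/permP => j; apply/esym/del_permP.
case: (eqVneq j a) => [->|ja].
  apply: from_i; case: (del_perm_next (s * t) a) => [|i'].
    by rewrite permM sa /t tpermL => /eqP; rewrite eq_rlshift.
  by rewrite permM sa /t tpermL => /rshift_inj <-.
by apply: away; [apply: del_perm_next|rewrite (inj_eq (@lshift_inj _ _))|rewrite eq_lrshift].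
Qed.

Lemma del_perm1 : del_perm (1 : 'S_(n + m)) = 1%g.
Proof.
apply/permP => i; apply: del_permP; apply: next_site_stop.
by rewrite !perm1.
Qed.

Lemma porbit_step (T : finType) (s : {perm T}) (x : T) : porbit s (s x) = porbit s x.
Proof. by have := porbit_perm s 1 x; rewrite expg1. Qed.

(** Deletion neither merges nor splits orbits that meet the sites; this makes the
    effect of a transposition of sites on the number of orbits the same before
    and after the deletion. *)
Lemma mem_porbit_del s a b :
  (lshift m a \in porbit s (lshift m b)) = (a \in porbit (del_perm s) b).
Proof.
apply/idP/idP.
  have reach k x j : next_site s x j -> iter k.+1 s x = lshift m a ->
      a \in porbit (del_perm s) j.
    elim: k x j => [|k IH] x j h /=.
      case: h => [->|i -> _]; first by move/lshift_inj->; exact: porbit_id.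
      by move/eqP; rewrite eq_rlshift.
    rewrite -iterS iterSr => e; case: h => [sx|i sx h]; last first.
      by apply: (IH (s x)) => //; rewrite sx.
    rewrite -porbit_step; apply: (IH (s x)) => //; rewrite sx.
    exact: del_perm_next.
  case/porbitP => k; rewrite permX => e.
  case: k e => [|k] e; first by rewrite (lshift_inj (esym e)) porbit_id.
  rewrite -porbit_step; apply: (reach k (lshift m b)) => //.
  exact: del_perm_next.
have orb x j : next_site s x j -> porbit s x = porbit s (lshift m j).
  elim=> {x j} [x j sx|x j i sx _ <-]; first by rewrite -sx porbit_step.
  by rewrite -sx porbit_step.
case/porbitP => k ->; rewrite permX -eq_porbit_mem; apply/eqP.
elim: k => //= k <-; exact/esym/orb/del_perm_next.
Qed.

Lemma card_porbits_mulC (T : finType) (s : {perm T}) (x y : T) :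
  #|porbits (s * tperm x y)| = #|porbits (tperm x y * s)|.
Proof.
rewrite -porbitsV invMg tpermV.
have := porbits_mul_tperm s^-1 x y; rewrite porbitV porbitsV /=.
by rewrite -(porbits_mul_tperm s x y) /= => /addIn.
Qed.

(** The exponent of [p] in the trace of [s]. *)
Definition lost s := (#|porbits s| - #|porbits (del_perm s)|)%N.

Lemma lost_mull_tperm s a b :
  lost (tperm (lshift m a) (lshift m b) * s) = lost s.
Proof.
rewrite /lost del_perm_mull_tperm.
have := porbits_mul_tperm s (lshift m a) (lshift m b).
have := porbits_mul_tperm (del_perm s) a b.
rewrite /= mem_porbit_del (inj_eq (@lshift_inj _ _)).
set X := _.*2; set Y := nat_of_bool _.
move: (#|porbits _|) (#|porbits _|) (#|porbits _|) (#|porbits _|) X Y.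
by move=> c1 c2 c3 c4 X Y; lia.
Qed.

Lemma lost_mulr_tperm s a b :
  lost (s * tperm (lshift m a) (lshift m b)) = lost s.
Proof.
rewrite -(lost_mull_tperm s a b) /lost card_porbits_mulC.
by rewrite del_perm_mulr_tperm del_perm_mull_tperm card_porbits_mulC.
Qed.

End Deletion.

(** * Group algebras of the symmetric groups of subsets *)

Lemma perm_onS (T : finType) (S S' : {set T}) (s : {perm T}) :
  S \subset S' -> perm_on S s -> perm_on S' s.
Proof. by move=> SS'; rewrite /perm_on => h; apply: fintype.subset_trans h SS'. Qed.

Section SupportedAlgebra.
Variables (F : fieldType) (n : nat).
Implicit Types (s t : 'S_n) (x y : symalg F n) (S : {set 'I_n}).

(** For [S] the first [m] points this is [sub_symalg F n m]; other sets [S]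
    express that an element leaves certain points alone. *)
Definition symalg_on S : {vspace symalg F n} :=
  <<[seq symb F s | s <- enum (Sym S)]>>%VS.

Lemma symb_on S s : perm_on S s -> symb F s \in symalg_on S.
Proof. by move=> sS; apply/memv_span/map_f; rewrite mem_enum inE. Qed.

Lemma symalg_onP x S :
  reflect (forall s, ~~ perm_on S s -> x s = 0) (x \in symalg_on S).
Proof.
apply: (iffP idP) => [|xS].
  move=> /coord_span -> s sS; rewrite sum_ffunE big1 // => i _.
  have i_lt : (i < size [seq symb F t | t <- enum (Sym S)])%N.
    by rewrite size_map -cardE.
  have /mapP[t tS e] := mem_nth 0 i_lt.
  move: tS; rewrite mem_enum inE => tS.
  rewrite ffunE [_`_i]e ffunE (_ : (s == t) = false) ?scaler0 //.
  by apply: contraNF sS => /eqP ->.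
rewrite (symalg_sum x); apply: memv_suml => s _.
case: (boolP (perm_on S s)) => [sS|/xS ->]; last by rewrite scale0r mem0v.
by rewrite memvZ // symb_on.
Qed.

Lemma symalg_onS S S' : S \subset S' -> (symalg_on S <= symalg_on S')%VS.
Proof.
move=> sub; apply/subvP => x /symalg_onP xS; apply/symalg_onP => s sS.
by apply: xS; apply: contra sS; apply: perm_onS.
Qed.

Lemma symalg_on1 S : 1 \in symalg_on S.
Proof. exact/symb_on/perm_on1. Qed.

Lemma symalg_onM S x y :
  x \in symalg_on S -> y \in symalg_on S -> x * y \in symalg_on S.
Proof.
move=> /symalg_onP xS /symalg_onP yS; rewrite [x * y]/GRing.mul /= /symalg_mul.
apply: memv_suml => s _; apply: memv_suml => t _.
case: (boolP (perm_on S s)) => [sS|/xS ->]; last by rewrite mul0r scale0r mem0v.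
case: (boolP (perm_on S t)) => [tS|/yS ->]; last by rewrite mulr0 scale0r mem0v.
by rewrite memvZ // symb_on // perm_onM.
Qed.

Lemma symalg_on_is_aspace S : is_aspace (symalg_on S).
Proof.
rewrite /is_aspace has_algid1 ?symalg_on1 //.
by apply/prodvP => x y; apply: symalg_onM.
Qed.
Canonical symalg_on_aspace S : {aspace symalg F n} :=
  ASpace (symalg_on_is_aspace S).

Lemma symalg_on_comm S S' x y : [disjoint S & S']%B ->
  x \in symalg_on S -> y \in symalg_on S' -> GRing.comm x y.
Proof.
move=> dis /symalg_onP xS /symalg_onP yS.
rewrite (symalg_sum x) (symalg_sum y) /GRing.comm mulr_suml mulr_sumr.
apply: eq_bigr => s _; rewrite mulr_sumr mulr_suml; apply: eq_bigr => t _.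
case: (boolP (perm_on S s)) => [sS|/xS ->]; last by rewrite scale0r mul0r mulr0.
case: (boolP (perm_on S' t)) => [tS|/yS ->]; last by rewrite scale0r mul0r mulr0.
rewrite -!scalerAl -!scalerAr !scalerA mulrC !symbM; congr (_ *: symb F _).
by apply/esym; exact: perm_onC sS tS dis.
Qed.

Lemma symb_tperm_on S a b :
  a \in S -> b \in S -> symb F (tperm a b) \in symalg_on S.
Proof.
move=> aS bS; apply: symb_on; apply: (perm_onS _ (tperm_on a b)); apply/fintype.subsetP => c.
by case/set2P=> ->.
Qed.

End SupportedAlgebra.

(** * The partial trace *)

Section Trace.
Variables (F : fieldType) (n m : nat) (p : F).
Implicit Types (s t : 'S_(n + m)) (x y : symalg F (n + m)) (a b : 'I_n).

Lemma Tr_is_linear : linear (@Tr F n m p).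
Proof.
move=> k x y; rewrite /Tr scaler_sumr -big_split; apply: eq_bigr => s _ /=.
by rewrite !ffunE mulrDl scalerDl -mulrA scalerA.
Qed.
HB.instance Definition _ :=
  GRing.isLinear.Build F (symalg F (n + m)) (symalg F n) _ (@Tr F n m p)
    Tr_is_linear.

Lemma Tr_symb s : Tr p (symb F s) = p ^+ lost s *: symb F (del_perm s).
Proof.
rewrite /Tr (bigD1 s) //= big1 => [|t ts]; first by rewrite ffunE eqxx mul1r addr0.
by rewrite ffunE (negPf ts) mul0r scale0r.
Qed.

Lemma Tr_mull_tperm a b x :
  Tr p (symb F (tperm (lshift m a) (lshift m b)) * x) =
  symb F (tperm a b) * Tr p x.
Proof.
rewrite (symalg_sum x) mulr_sumr !linear_sum mulr_sumr; apply: eq_bigr => s _.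
rewrite -scalerAr !linearZ /= -scalerAr symbM !Tr_symb -scalerAr symbM.
by rewrite lost_mulr_tperm del_perm_mulr_tperm.
Qed.

Lemma Tr_mulr_tperm a b x :
  Tr p (x * symb F (tperm (lshift m a) (lshift m b))) =
  Tr p x * symb F (tperm a b).
Proof.
rewrite (symalg_sum x) mulr_suml !linear_sum mulr_suml; apply: eq_bigr => s _.
rewrite -scalerAl !linearZ /= -scalerAl symbM !Tr_symb -scalerAl symbM.
by rewrite lost_mull_tperm del_perm_mull_tperm.
Qed.

(** The trace is not cyclic, as the sites survive it.  This much of cyclicity
    holds because the place of [a] next to a deleted symbol is immaterial. *)
Lemma Tr_swap a (i : 'I_m) x : x \in symalg_on F [set~ lshift m a] ->
  Tr p (x * symb F (tperm (lshift m a) (rshift n i))) =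
  Tr p (symb F (tperm (lshift m a) (rshift n i)) * x).
Proof.
move=> /symalg_onP xa; rewrite (symalg_sum x) mulr_suml mulr_sumr !linear_sum.
apply: eq_bigr => s _; rewrite -scalerAl -scalerAr !linearZ /=.
case: (boolP (perm_on [set~ lshift m a] s)) => [sa|/xa ->]; last by rewrite !scale0r.
have {}sa : s (lshift m a) = lshift m a by apply: out_perm sa _; rewrite !inE eqxx.
by rewrite !symbM !Tr_symb /lost (del_perm_swap i sa) card_porbits_mulC.
Qed.

End Trace.

Lemma card_porbits1 n : #|porbits (1%g : 'S_n)| = n.
Proof.
rewrite card_imset; first by rewrite card_ord.
by move=> i j /setP/(_ i); rewrite porbit_id => /esym/porbitP[k ->];
  rewrite expg1n perm1.
Qed.

Lemma Tr1 (F : fieldType) n (p : F) : Tr p (1 : symalg F (n + 1)) = p *: 1.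
Proof.
rewrite -symb1 Tr_symb /lost del_perm1 !card_porbits1.
by rewrite addnC addnK expr1.
Qed.

Lemma Tr_tperm (F : fieldType) n (p : F) (a : 'I_n) :
  Tr p (symb F (tperm (lshift 1 a) (rshift n ord0))) = 1.
Proof.
set t := tperm _ _; rewrite Tr_symb.
have delt : del_perm t = 1%g.
  apply/permP => i; rewrite perm1; apply: del_permP.
  case: (eqVneq i a) => [->|ia].
    apply: (@next_site_step _ _ _ _ _ ord0); first by rewrite tpermL.
    by apply: next_site_stop; rewrite tpermR.
  apply: next_site_stop; rewrite tpermD //; last by rewrite eq_rlshift.
  by rewrite (inj_eq (@lshift_inj _ _)) eq_sym.
have := porbits_mul_tperm 1 (lshift 1 a) (rshift n ord0).
rewrite /= mulg1 card_porbits1 eq_lrshift /lost delt card_porbits1 -/t.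
rewrite (_ : _ \notin _); last first.
  apply/negP => /porbitP[k]; rewrite expg1n perm1 => /eqP.
  by rewrite eq_lrshift.
move: #|porbits t| => c /= e.
by rewrite (_ : c = n) ?subnn ?expr0 ?scale1r //; lia.
Qed.

(** * Exchange relations *)

Lemma symb_tperm (F : fieldType) n (u : 'S_n) (i j : 'I_n) :
  symb F u * symb F (tperm i j) = symb F (tperm (u i) (u j)) * symb F u.
Proof. by rewrite !symbM conjgC tpermJ. Qed.

(** The Yang-Baxter (RTT) relation in the form that transfer matrices need: the
    spectral parameter [v - u] of the R-matrix is the difference of those of the
    two factors, and the R-matrix compensates the failure of [x] and [y] to
    commute. *)
Lemma rtt_relation (S : nzRingType) (u v x y s : S) :
  (forall w, u * w = w * u) -> (forall w, v * w = w * v) ->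
  s * x = y * s -> s * y = x * s -> x * y - y * x = s * (x - y) ->
  (v - u + s) * (v + y) * (u + x) = (u + x) * (v + y) * (v - u + s).
Proof.
move=> cu cv sx sy xy; set d := v - u.
have cd w : d * w = w * d by rewrite /d mulrBl mulrBr cu cv.
have e : (v + x) * (u + y) - (u + x) * (v + y) = d * (y - x).
  rewrite (_ : v + x = d + (u + x)); last by rewrite addrA subrK.
  rewrite (_ : v + y = d + (u + y)); last by rewrite addrA subrK.
  rewrite mulrDl [(u + x) * (d + _)]mulrDr -(cd (u + x)) opprD addrACA subrr.
  rewrite addr0 -mulrBr.
  by rewrite opprD addrACA subrr add0r.
have ss : s * (v + y) * (u + x) = (v + x) * (u + y) * s.
  have -> : s * (v + y) = (v + x) * s by rewrite mulrDr mulrDl cv sy.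
  by rewrite -!mulrA; congr (_ * _); rewrite mulrDr mulrDl cu sx.
have ba : (v + y) * (u + x) = (u + x) * (v + y) - (y - x) * s.
  have -> : (y - x) * s = s * (x - y) by rewrite mulrBl mulrBr sx sy.
  rewrite -xy opprB !mulrDl !mulrDr (cu v) (cu y) (cv x).
  rewrite [RHS](AC ((2*2)*2) ((1*3*2*5)*(4*6))) /= subrr addr0.
  by rewrite [LHS](AC (2*2) (1*2*3*4)).
rewrite [(d + s) * _]mulrDl [LHS]mulrDl ss -[d * _ * _]mulrA ba mulrBr.
rewrite [RHS]mulrDr -(cd ((u + x) * (v + y))) -addrA; congr (_ + _).
by rewrite mulrA -e mulrBl opprB subrK.
Qed.

Lemma comm_prod_seq (S : nzRingType) (I : eqType) (c : S) (L : I -> S) s :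
  {in s, forall b, GRing.comm c (L b)} -> GRing.comm c (\prod_(b <- s) L b).
Proof. by move=> com; rewrite big_seq; apply: commr_prod. Qed.

(** Carrying [c] through a product of factors [L b], one exchange at a time. *)
Lemma exchange_through (S : nzRingType) (I : eqType) (c : S) (R L : I -> S) s :
  uniq s ->
  {in s, forall b, R b * L b * c = c * L b * R b} ->
  {in s &, forall b b', b != b' -> R b * L b' = L b' * R b} ->
  \prod_(b <- s) R b * \prod_(b <- s) L b * c =
  c * \prod_(b <- s) L b * \prod_(b <- s) R b.
Proof.
elim: s => [|b s IH]; first by rewrite !big_nil !mulr1 mul1r.
move=> /= /andP[bs us] ex com; rewrite !big_cons.
have in_s b' : b' \in s -> b' \in b :: s by move=> h; rewrite in_cons h orbT.
have neq b' : b' \in s -> b' != b by apply: contraTneq => ->.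
have {}IH : \prod_(b <- s) R b * \prod_(b <- s) L b * c =
    c * \prod_(b <- s) L b * \prod_(b <- s) R b.
  apply: IH => // [b' /in_s/ex //|b1 b2 /in_s h1 /in_s h2]; exact: com.
have RL : L b * \prod_(b' <- s) R b' = \prod_(b' <- s) R b' * L b.
  apply: comm_prod_seq => b' b's; apply/esym/com; rewrite ?mem_head ?neq //.
  exact: in_s.
have LR : R b * \prod_(b' <- s) L b' = \prod_(b' <- s) L b' * R b.
  apply: comm_prod_seq => b' b's; apply: com; rewrite ?mem_head 1?eq_sym ?neq //.
  exact: in_s.
move: IH RL LR (ex b (mem_head _ _)).
set R' := \prod_(b <- s) R b; set L' := \prod_(b <- s) L b => IH RL LR ex_b.
have RLw w : R' * (L b * w) = L b * (R' * w) by rewrite mulrA -RL mulrA.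
have LRw w : R b * (L' * w) = L' * (R b * w) by rewrite mulrA LR mulrA.
have ex_bw w : R b * (L b * (c * w)) = c * (L b * (R b * w)).
  by rewrite !mulrA ex_b.
by rewrite -!mulrA in IH *; rewrite RLw IH ex_bw LRw.
Qed.

Section CoefsIn.
Variables (K : fieldType) (A : falgType K) (V : {aspace A}).
Hypothesis V1 : 1 \in V.

Definition coefs_in (q : {poly A}) := forall i, q`_i \in V.

Lemma coefs_inD q r : coefs_in q -> coefs_in r -> coefs_in (q + r).
Proof. by move=> hq hr i; rewrite coefD memvD. Qed.

Lemma coefs_inM q r : coefs_in q -> coefs_in r -> coefs_in (q * r).
Proof.
by move=> hq hr i; rewrite coefM; apply: memv_suml => j _; apply: memvM.
Qed.

Lemma coefs_inC c : c \in V -> coefs_in c%:P.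
Proof. by move=> cV i; rewrite coefC; case: eqP => // _; exact: mem0v. Qed.

Lemma coefs_inX : coefs_in 'X.
Proof. by move=> i; rewrite coefX; case: eqP => // _; exact: mem0v. Qed.

Lemma coefs_in_prod (I : eqType) (L : I -> {poly A}) s :
  {in s, forall b, coefs_in (L b)} -> coefs_in (\prod_(b <- s) L b).
Proof.
move=> h; rewrite big_seq; apply: (big_ind coefs_in) => //.
  exact: coefs_inC.
exact: coefs_inM.
Qed.

End CoefsIn.

(** * The commuting Hamiltonians *)

Section Bethe.
Variables (F : fieldType) (n m : nat) (hbar : F) (z : 'I_n -> F).
Implicit Types (a b : 'I_n) (s : seq 'I_n).

Local Notation sw i j := (symb F (tperm i j)).
Local Notation L := (bethe_factor m hbar z).

(** The part of the factor at the site [a] that depends neither on the variable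
    nor on [z]. *)
Definition hop a : symalg F (n + m) :=
  \sum_(i < m) sw (lshift m a) (rshift n i).

(** The R-matrix of the sites [b] and [a], at the difference of their parameters;
    [rmat_ext] is the same element in the larger group algebra. *)
Definition rmat b a : symalg F n := (z a - z b)%:A + hbar *: sw b a.
Definition rmat_ext b a : symalg F (n + m) :=
  (z a - z b)%:A + hbar *: sw (lshift m b) (lshift m a).

Definition ham s a := \prod_(b <- s) rmat b a.
Definition ham_ext s a := \prod_(b <- s) rmat_ext b a.

Lemma sw_hop b a : sw (lshift m b) (lshift m a) * hop a =
  hop b * sw (lshift m b) (lshift m a).
Proof.
rewrite /hop mulr_sumr mulr_suml; apply: eq_bigr => i _.
by rewrite symb_tperm tpermR tpermL_rshift.
Qed.

(** Transpositions through different auxiliary points commute; through the same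
    auxiliary point they are related by conjugation. *)
Lemma hop_bracket a b : a != b ->
  hop a * hop b - hop b * hop a = sw (lshift m b) (lshift m a) * (hop a - hop b).
Proof.
move=> ab; rewrite /hop !big_distrlr /= [X in _ - X]exchange_big -sumrB /=.
rewrite -sumrB mulr_sumr; apply: eq_bigr => i _.
rewrite -sumrB (bigD1 i) //= big1 ?addr0 => [|j ji].
  have ba : lshift m b != lshift m a by rewrite (inj_eq (@lshift_inj _ _)) eq_sym.
  rewrite mulrBr; congr (_ - _).
    by rewrite [LHS]symb_tperm tpermR tpermD // ?eq_rlshift // eq_sym.
  rewrite [LHS]symb_tperm tpermR tpermD ?eq_rlshift //.
  by rewrite (tpermC (lshift m a)).
have abN : lshift m a != lshift m b by rewrite (inj_eq (@lshift_inj _ _)).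
have ijN : rshift n i != rshift n j by rewrite (inj_eq (@rshift_inj _ _)) eq_sym.
by rewrite symb_tperm !tpermD ?subrr ?eq_lrshift ?eq_rlshift // eq_sym.
Qed.

Lemma rtt a b : a != b ->
  (rmat_ext b a)%:P * L b * L a = L a * L b * (rmat_ext b a)%:P.
Proof.
move=> ab; set u : {poly symalg F (n + m)} := 'X - ((z a)%:A)%:P.
set v : {poly symalg F (n + m)} := 'X - ((z b)%:A)%:P.
have -> : (rmat_ext b a)%:P = v - u + (hbar *: sw (lshift m b) (lshift m a))%:P.
  rewrite /rmat_ext polyCD; congr (_ + _).
  by rewrite /u /v opprD opprK addrACA subrr add0r addrC scalerBl polyCB.
have central c w : ('X - (c%:A)%:P) * w = w * ('X - (c%:A)%:P) :> {poly symalg F (n + m)}.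
  rewrite mulrBl mulrBr commr_polyX; congr (_ - _).
  by apply/polyP => i; rewrite coefCM coefMC mulr_algl mulr_algr.
apply: rtt_relation; [exact: central|exact: central|..].
- by rewrite -!polyCM -!scalerAl -!scalerAr sw_hop.
- rewrite -!polyCM -!scalerAl -!scalerAr tpermC sw_hop.
  by [].
- rewrite -!polyCM -!polyCB -!polyCM -scalerBr -!scalerAl -!scalerAr.
  by rewrite -!scalerBr hop_bracket.
Qed.

Definition aux_points : {set 'I_(n + m)} := [set rshift n i | i : 'I_m].

Lemma lshift_aux a : lshift m a \notin aux_points.
Proof. by apply/imsetP => -[i _ /eqP]; rewrite eq_lrshift. Qed.

Lemma hop_on a : hop a \in symalg_on F (lshift m a |: aux_points).
Proof.
apply: memv_suml => i _; apply: symb_tperm_on; rewrite !inE ?eqxx //.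
by rewrite imset_f ?orbT.
Qed.

Lemma factor_in (V : {aspace symalg F (n + m)}) a :
  1 \in V -> hop a \in V -> coefs_in V (L a).
Proof.
move=> V1 Va; rewrite /bethe_factor; apply: coefs_inD; last first.
  by apply: coefs_inC; rewrite memvZ.
apply: coefs_inD; first exact: coefs_inX.
by rewrite -polyCN; apply: coefs_inC; rewrite memvN memvZ.
Qed.

Lemma comm_polyC (S : nzRingType) (c : S) (q : {poly S}) :
  (forall i, c * q`_i = q`_i * c) -> c%:P * q = q * c%:P.
Proof. by move=> h; apply/polyP => i; rewrite coefCM coefMC. Qed.

Lemma comm_factor (c : symalg F (n + m)) a :
  c * hop a = hop a * c -> c%:P * L a = L a * c%:P.
Proof.
move=> ca; apply: comm_polyC => i; rewrite /bethe_factor !coefD coefN !coefC coefX.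
rewrite !mulrDl !mulrDr; congr (_ + _ + _).
- by rewrite mulr_natl mulr_natr.
- case: (i == 0)%N; last by rewrite oppr0 mul0r mulr0.
  by rewrite mulrN mulNr mulr_algl mulr_algr.
- case: (i == 0)%N; last by rewrite mul0r mulr0.
  by rewrite -scalerAl -scalerAr ca.
Qed.

Lemma rmat_factor_comm b a c : c != a -> c != b ->
  (rmat_ext b a)%:P * L c = L c * (rmat_ext b a)%:P.
Proof.
move=> ca cb; apply: comm_factor; rewrite /rmat_ext mulrDl mulrDr.
rewrite mulr_algl mulr_algr -scalerAl -scalerAr; congr (_ + _ *: _).
rewrite /hop mulr_sumr mulr_suml; apply: eq_bigr => i _.
by rewrite symb_tperm tpermL_rshift tpermL_lshift tpermD // eq_sym.
Qed.

Lemma shift_perm_lshift (s : 'S_m) a : shift_perm n s (lshift m a) = lshift m a.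
Proof.
rewrite permE /shift_fun; case: split_ordP => j /eqP; last by rewrite eq_lrshift.
by move=> /eqP/lshift_inj ->.
Qed.

Lemma shift_perm_rshift (s : 'S_m) i :
  shift_perm n s (rshift n i) = rshift n (s i).
Proof.
rewrite permE /shift_fun; case: split_ordP => j /eqP; first by rewrite eq_rlshift.
by move=> /eqP/rshift_inj ->.
Qed.

Lemma shift_perm_on (s : 'S_m) : perm_on aux_points (shift_perm n s).
Proof.
apply/fintype.subsetP => x; rewrite inE permE /shift_fun.
by case: (split_ordP x) => i ->; rewrite ?eqxx // imset_f.
Qed.

Lemma symalg_shift_on (x : symalg F m) :
  symalg_shift n x \in symalg_on F aux_points.
Proof.
by apply: memv_suml => s _; rewrite memvZ // symb_on // shift_perm_on.
Qed.

Lemma symalg_shift_hop (x : symalg F m) b :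
  symalg_shift n x * hop b = hop b * symalg_shift n x.
Proof.
rewrite /symalg_shift mulr_suml mulr_sumr; apply: eq_bigr => s _.
rewrite -scalerAl -scalerAr; congr (_ *: _); rewrite /hop mulr_sumr mulr_suml.
rewrite [RHS](reindex_inj (@perm_inj _ s)); apply: eq_bigr => i _ /=.
by rewrite symb_tperm shift_perm_lshift shift_perm_rshift.
Qed.

Lemma symalg_shift_rmat (x : symalg F m) b a :
  symalg_shift n x * rmat_ext b a = rmat_ext b a * symalg_shift n x.
Proof.
rewrite /rmat_ext mulrDl mulrDr mulr_algl mulr_algr -scalerAl -scalerAr.
congr (_ + _ *: _); apply: (@symalg_on_comm _ _ aux_points [set lshift m b; lshift m a]).
- rewrite disjoint_subset; apply/fintype.subsetP => c /imsetP[i _ ->].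
  by rewrite inE; apply/negP => /set2P[] /eqP; rewrite eq_rlshift.
- exact: symalg_shift_on.
- by apply: symb_tperm_on; rewrite !inE eqxx ?orbT.
Qed.

End Bethe.

Section TracePoly.
Variables (F : fieldType) (n m : nat) (p hbar : F) (z : 'I_n -> F).
Implicit Types (a b : 'I_n) (s : seq 'I_n) (q : {poly symalg F (n + m)}).

Local Notation L := (bethe_factor m hbar z).
Local Notation TrP := (map_poly (@Tr F n m p)).

Lemma coef_TrP q i : (TrP q)`_i = Tr p q`_i.
Proof. by rewrite coef_map_id0 // linear0. Qed.

Lemma Tr_mull_ham s a (x : symalg F (n + m)) :
  Tr p (ham_ext m hbar z s a * x) = ham hbar z s a * Tr p x.
Proof.
elim: s => [|b s IH]; first by rewrite /ham_ext /ham !big_nil !mul1r.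
rewrite /ham_ext /ham !big_cons -/(ham_ext m hbar z s a) -/(ham hbar z s a).
rewrite -!mulrA -IH /rmat_ext /rmat !mulrDl !mulr_algl -!scalerAl.
by rewrite linearD !linearZ /= Tr_mull_tperm.
Qed.

Lemma Tr_mulr_ham s a (x : symalg F (n + m)) :
  Tr p (x * ham_ext m hbar z s a) = Tr p x * ham hbar z s a.
Proof.
elim: s x => [|b s IH] x; first by rewrite /ham_ext /ham !big_nil !mulr1.
rewrite /ham_ext /ham !big_cons -/(ham_ext m hbar z s a) -/(ham hbar z s a).
rewrite !mulrA IH; congr (_ * _); rewrite /rmat_ext /rmat !mulrDr !mulr_algr.
by rewrite -!scalerAr linearD !linearZ /= Tr_mulr_tperm.
Qed.

Lemma TrP_mull_ham s a q :
  TrP ((ham_ext m hbar z s a)%:P * q) = (ham hbar z s a)%:P * TrP q.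
Proof. by apply/polyP => i; rewrite coef_TrP !coefCM coef_TrP Tr_mull_ham. Qed.

Lemma TrP_mulr_ham s a q :
  TrP (q * (ham_ext m hbar z s a)%:P) = TrP q * (ham hbar z s a)%:P.
Proof. by apply/polyP => i; rewrite coef_TrP !coefMC coef_TrP Tr_mulr_ham. Qed.

Lemma TrP_swap_factor a q : coefs_in [aspace of symalg_on F [set~ lshift m a]] q ->
  TrP (L a * q) = TrP (q * L a).
Proof.
move=> qa; apply/polyP => i; rewrite !coef_TrP /bethe_factor !mulrDl !mulrDr.
rewrite mulNr mulrN -(commr_polyX q) !coefD !coefN !coefCM !coefMC !linearD !linearN.
rewrite mulr_algl mulr_algr; congr (_ + _).
rewrite -scalerAl -scalerAr !linearZ mulr_suml mulr_sumr !linear_sum /=.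
congr (_ *: _); apply: eq_bigr => j _; rewrite Tr_swap //; exact: qa.
Qed.

(** Multiplication by [ham s1 a] carries the factor at [a] to the left end of the
    product, the trace moves it to the right end, and multiplication by
    [ham s2 a] carries it back to its place. *)
Lemma ham_comm_trace s1 s2 a (x : symalg F m) : uniq (s1 ++ a :: s2) ->
  let T := TrP ((symalg_shift n x)%:P * \prod_(b <- s1 ++ a :: s2) L b) in
  let H := ham hbar z s2 a * ham hbar z s1 a in H%:P * T = T * H%:P.
Proof.
move=> uq T H; move: uq; rewrite cat_uniq /=.
move=> /and3P[us1 /norP[as1 /hasPn s12] /andP[as2 us2]].
have neq b s : a \notin s -> b \in s -> b != a by move=> aN; apply: contraTneq => ->.
have ne12 b c : b \in s1 -> c \in s2 -> c != b.
  by move=> b1 c2; apply: contraTneq b1 => <-; apply: s12.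
pose P := ham_ext m hbar z s1 a; pose Q := ham_ext m hbar z s2 a.
pose U := \prod_(b <- s1) L b; pose D := \prod_(b <- s2) L b.
pose A := (symalg_shift n x)%:P.
have hamE s : (ham_ext m hbar z s a)%:P = \prod_(b <- s) (rmat_ext m hbar z b a)%:P.
  by rewrite /ham_ext rmorph_prod.
have through s : uniq s -> a \notin s ->
    (ham_ext m hbar z s a)%:P * \prod_(b <- s) L b * L a =
    L a * \prod_(b <- s) L b * (ham_ext m hbar z s a)%:P.
  move=> us as'; rewrite hamE; apply: exchange_through => // [b bs|b c bs cs bc].
    by apply: rtt; rewrite eq_sym (neq _ s).
  by rewrite rmat_factor_comm // 1?eq_sym // eq_sym (neq _ s).
have comP s s' : (forall b c, b \in s -> c \in s' -> c != b) -> a \notin s' ->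
    (ham_ext m hbar z s a)%:P * \prod_(b <- s') L b =
    \prod_(b <- s') L b * (ham_ext m hbar z s a)%:P.
  move=> ss' as'; rewrite hamE; apply: comm_prod_seq => c cs'.
  apply/commr_sym/comm_prod_seq => b bs; apply/commr_sym.
  by apply: rmat_factor_comm; [apply: neq as' cs'|apply: ss'].
have PD : P%:P * D = D * P%:P by apply: comP.
have QU : Q%:P * U = U * Q%:P.
  by apply: comP => // b c bs cs; rewrite eq_sym ne12.
have Aham s : (ham_ext m hbar z s a)%:P * A = A * (ham_ext m hbar z s a)%:P.
  rewrite hamE; apply/esym/comm_prod_seq => b _.
  by rewrite /GRing.comm /A -!polyCM symalg_shift_rmat.
have AL b : A * L b = L b * A by apply: comm_factor; apply: symalg_shift_hop.
have TE : T = TrP (A * (U * (L a * D))) by rewrite /T big_cat big_cons.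
(* The factors other than [L a] leave [a] alone, so the trace is cyclic here. *)
have swap : TrP (A * (L a * (U * D))) = TrP (A * (U * (D * L a))).
  rewrite (mulrA A) AL -mulrA TrP_swap_factor ?mulrA //.
  have V1 := symalg_on1 F [set~ lshift m a].
  have auxa : aux_points n m \subset [set~ lshift m a]%SET.
    apply/fintype.subsetP => i i_aux; rewrite in_setC1; apply: contraTneq i_aux => ->.
    exact: lshift_aux.
  have Lin b : b != a -> coefs_in [aspace of symalg_on F [set~ lshift m a]] (L b).
    move=> ba; apply: factor_in => //; apply: (subvP (symalg_onS _ _)) (hop_on _ _ b).
    by rewrite finset.subUset finset.sub1set in_setC1 (inj_eq (@lshift_inj _ _)) ba.
  apply: coefs_inM; first apply: coefs_inM.
  - by apply: coefs_inC; apply: (subvP (symalg_onS _ auxa)); apply: symalg_shift_on.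
  - by apply: coefs_in_prod => // b bs; apply/Lin/(neq _ s1).
  - by apply: coefs_in_prod => // b bs; apply/Lin/(neq _ s2).
have step : TrP (Q%:P * (P%:P * (A * (U * (L a * D))))) = H%:P * T.
  by rewrite !TrP_mull_ham /H polyCM mulrA TE.
have step' : TrP (A * (U * (L a * D)) * (Q%:P * P%:P)) = T * H%:P.
  by rewrite [_ * (Q%:P * _)]mulrA !TrP_mulr_ham /H polyCM [RHS]mulrA TE.
rewrite -step -step'.
have -> : P%:P * (A * (U * (L a * D))) = A * (L a * (U * D)) * P%:P.
  rewrite mulrA (Aham s1) -!mulrA; congr (_ * _).
  by rewrite !mulrA through // -!mulrA PD.
rewrite mulrA TrP_mulr_ham TrP_mull_ham swap -TrP_mull_ham -TrP_mulr_ham.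
congr TrP; rewrite !mulrA; congr (_ * _).
rewrite Aham -!mulrA; congr (_ * _); rewrite (mulrA _ U) QU -!mulrA; congr (_ * _).
by rewrite !mulrA through.
Qed.

End TracePoly.

Lemma agenv_sub_aspace (K : fieldType) (E : falgType K) (U : {vspace E})
    (A : {aspace E}) : 1 \in A -> (U <= A)%VS -> (agenv U <= A)%VS.
Proof.
move=> A1 UA; apply: agenv_sub_modl; first by rewrite -memvE.
exact: prodv_sub UA (subvv _).
Qed.

Section Hamiltonians.
Variables (F : fieldType) (n : nat) (p hbar : F) (z : 'I_n -> F).
Implicit Types (a b : 'I_n).

(** The sites in decreasing order, as in the transfer matrices. *)
Definition site_seq : seq 'I_n := [seq rev_ord a | a <- index_enum 'I_n].
Definition sites_before a := take (index a site_seq) site_seq.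
Definition sites_after a := drop (index a site_seq).+1 site_seq.

Lemma mem_site_seq a : a \in site_seq.
Proof. by apply/mapP; exists (rev_ord a); rewrite ?mem_index_enum ?rev_ordK. Qed.

Lemma site_seqE a : site_seq = sites_before a ++ a :: sites_after a.
Proof.
rewrite -{1}(cat_take_drop (index a site_seq) site_seq).
by rewrite (drop_nth a) ?nth_index ?index_mem // mem_site_seq.
Qed.

Lemma uniq_site_seq : uniq site_seq.
Proof. by rewrite map_inj_uniq ?index_enum_uniq //; apply: rev_ord_inj. Qed.

Lemma uniq_site_split a : uniq (sites_before a ++ a :: sites_after a).
Proof. by rewrite -site_seqE uniq_site_seq. Qed.

(** Up to the factor [hbar], this is [T_1] at the point [z a]. *)
Definition hamiltonian a : symalg F n :=
  ham hbar z (sites_after a) a * ham hbar z (sites_before a) a.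

Lemma betheT_seq m : betheT m p hbar z =
  map_poly (@Tr F n m p) ((symalg_shift n (antisym F m))%:P *
    \prod_(b <- site_seq) bethe_factor m hbar z b).
Proof. by rewrite /betheT /site_seq big_map. Qed.

Lemma hamiltonian_comm a m i :
  GRing.comm (hamiltonian a) (bethe_coef m i p hbar z).
Proof.
have := ham_comm_trace p hbar z (antisym F m) (uniq_site_split a).
rewrite /= -site_seqE -betheT_seq -/(hamiltonian a) => /polyP/(_ (n - i)%N).
by rewrite coefCM coefMC.
Qed.

Lemma horner_scalarM N (c : F) (q r : {poly symalg F N}) :
  (q * r).[c%:A] = q.[c%:A] * r.[c%:A].
Proof. by apply: hornerM_comm; rewrite /comm_poly mulr_algl mulr_algr. Qed.

Lemma horner_scalar_prod N (c : F) (I : Type) (L : I -> {poly symalg F N}) s :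
  (\prod_(b <- s) L b).[c%:A] = \prod_(b <- s) (L b).[c%:A].
Proof.
elim: s => [|b s IH]; first by rewrite !big_nil hornerC.
by rewrite !big_cons horner_scalarM IH.
Qed.

Lemma horner_scalarE N (c : F) (q : {poly symalg F N}) k : (size q <= k)%N ->
  q.[c%:A] = \sum_(i < k) c ^+ i *: q`_i.
Proof.
move=> /horner_coef_wide ->; apply: eq_bigr => i _.
by rewrite exprZn expr1n mulr_algr.
Qed.

Lemma TrP_horner m (c : F) (q : {poly symalg F (n + m)}) :
  (map_poly (@Tr F n m p) q).[c%:A] = Tr p q.[c%:A].
Proof.
rewrite (horner_scalarE _ (leqnn (size q))) (horner_scalarE _ (size_poly _ _)).
rewrite linear_sum; apply: eq_bigr => i _; rewrite linearZ /= -coef_TrP.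
by [].
Qed.

Lemma symalg_shift_antisym1 : symalg_shift n (antisym F 1) = 1.
Proof.
have S1 (s : 'S_1) : s = 1%g by apply/permP => i; rewrite !ord1.
have sum1 (V : nmodType) (f : 'S_1 -> V) : \sum_s f s = f 1%g.
  by rewrite (bigD1 1%g) //= big1 ?addr0 // => s; rewrite (S1 s) eqxx.
rewrite /symalg_shift sum1 /antisym sum1 (_ : 1`! = 1%N) // invr1 scale1r odd_perm1 scale1r.
rewrite ffunE eqxx scale1r -symb1; congr (symb F _).
apply/permP => x; rewrite perm1; case: (split_ordP x) => i ->.
  by rewrite shift_perm_lshift.
by rewrite shift_perm_rshift perm1.
Qed.

Lemma factor1_horner (c : F) b : (bethe_factor 1 hbar z b).[c%:A] =
  (c - z b)%:A + hbar *: symb F (tperm (lshift 1 b) (rshift n ord0)).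
Proof.
by rewrite /bethe_factor !hornerE big_ord1 scalerBl.
Qed.

Lemma comm_affine (A : algType F) (k h : F) (x y : A) :
  GRing.comm x y -> GRing.comm (k%:A + h *: x) y.
Proof.
by move=> xy; rewrite /GRing.comm mulrDl mulrDr mulr_algl mulr_algr -scalerAl
  -scalerAr xy.
Qed.

(** At [z a] the factor at [a] is a multiple of the transposition [sa] with the
    auxiliary point; conjugation by [sa] turns the other factors into R-matrices,
    and only [sa] is left under the trace. *)
Lemma betheT1_horner a : (betheT 1 p hbar z).[(z a)%:A] = hbar *: hamiltonian a.
Proof.
rewrite betheT_seq TrP_horner horner_scalarM hornerC symalg_shift_antisym1 mul1r.
rewrite horner_scalar_prod (site_seqE a) big_cat big_cons /=.
pose r : 'I_(n + 1) := rshift n ord0; pose sa := symb F (tperm (lshift 1 a) r).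
have -> : (bethe_factor 1 hbar z a).[(z a)%:A] = hbar *: sa.
  by rewrite factor1_horner subrr scale0r add0r.
pose g b := (z a - z b)%:A + hbar *: symb F (tperm (lshift 1 b) r).
have gE s : \prod_(b <- s) (bethe_factor 1 hbar z b).[(z a)%:A] = \prod_(b <- s) g b.
  by apply: eq_bigr => b _; rewrite factor1_horner.
rewrite !gE.
have := uniq_site_split a; rewrite cat_uniq /=.
move=> /and3P[us1 /norP[as1 /hasPn s12] /andP[as2 us2]].
have g_sa b : b != a -> sa * g b = rmat_ext 1 hbar z b a * sa.
  move=> ba; rewrite /g /rmat_ext mulrDr mulrDl mulr_algl mulr_algr.
  rewrite -scalerAl -scalerAr; congr (_ + _ *: _); rewrite symb_tperm tpermR.
  by rewrite tpermD ?eq_rlshift // (inj_eq (@lshift_inj _ _)) eq_sym.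
have sa_g b : b != a -> g b * sa = sa * rmat_ext 1 hbar z b a.
  move=> ba; rewrite /g /rmat_ext mulrDr mulrDl mulr_algl mulr_algr.
  rewrite -scalerAl -scalerAr [sa * _]symb_tperm tpermL.
  by rewrite tpermD ?eq_rlshift // (inj_eq (@lshift_inj _ _)) eq_sym.
have prod_g_sa s : a \notin s ->
    sa * \prod_(b <- s) g b = ham_ext 1 hbar z s a * sa.
  rewrite /ham_ext; elim: s => [|b s IH]; first by rewrite !big_nil mulr1 mul1r.
  rewrite in_cons negb_or eq_sym => /andP[ba as']; rewrite !big_cons.
  by rewrite mulrA g_sa // -!mulrA IH.
have prod_sa_g s : a \notin s ->
    \prod_(b <- s) g b * sa = sa * ham_ext 1 hbar z s a.
  rewrite /ham_ext; elim: s => [|b s IH]; first by rewrite !big_nil mulr1 mul1r.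
  rewrite in_cons negb_or eq_sym => /andP[ba as']; rewrite !big_cons.
  by rewrite -[LHS]mulrA IH // [LHS]mulrA sa_g // -mulrA.
have com : \prod_(b <- sites_before a) g b * ham_ext 1 hbar z (sites_after a) a =
    ham_ext 1 hbar z (sites_after a) a * \prod_(b <- sites_before a) g b.
  apply/comm_prod_seq => c c2; apply/esym/comm_prod_seq => b b1; apply/esym.
  have ba : b != a by apply: contraTneq b1 => ->.
  have bc : b != c by apply: contraTneq b1 => ->; apply: s12.
  have ca : c != a by apply: contraTneq c2 => ->.
  apply: comm_affine; apply/commr_sym/comm_affine; rewrite /GRing.comm.
  by rewrite [LHS]symb_tperm !tpermD ?eq_lrshift // (inj_eq (@lshift_inj _ _)) eq_sym.
move: com (prod_g_sa _ as2) (prod_sa_g _ as1).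
move: (\prod_(b <- _) g b) (\prod_(b <- _) g b) => x y com xE yE.
rewrite -scalerAl -scalerAr xE mulrA com -mulrA yE.
by rewrite linearZ /= mulrA Tr_mulr_ham Tr_mull_ham Tr_tperm mulr1.
Qed.

Lemma bethe_coef_in m i : (0 < m < n)%N -> (0 < i <= n)%N ->
  bethe_coef m i p hbar z \in bethe_alg p hbar z.
Proof.
move=> /andP[m0 mn] /andP[i0 i_n]; apply/(subvP (sub_agenv _))/memv_span.
apply: (allpairs_f (fun m i => bethe_coef m i p hbar z)).
  by rewrite mem_iota m0 add1n prednK // (leq_ltn_trans _ mn).
by rewrite mem_iota i0 add1n ltnS.
Qed.

(** The Bethe subalgebra contains the lower coefficients of [T_1] by definition
    and the leading one because it is the scalar [p]. *)
Lemma hamiltonian_in a : (1 < n)%N -> hbar != 0 ->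
  hamiltonian a \in bethe_alg p hbar z.
Proof.
move=> n1 h0; rewrite -[hamiltonian a](scalerK h0) -betheT1_horner memvZ //.
pose c b := (z b)%:A - hbar *: \sum_(i < 1) symb F (tperm (lshift 1 b) (rshift n i)).
pose P := \prod_(b <- site_seq) ('X - (c b)%:P).
have TE : betheT 1 p hbar z = map_poly (@Tr F n 1 p) P.
  rewrite betheT_seq symalg_shift_antisym1 mul1r; congr map_poly.
  by apply: eq_bigr => b _; rewrite /bethe_factor polyCB opprB addrCA addrC.
have szP : size P = n.+1.
  by rewrite size_prod_XsubC /site_seq size_map -sum1_size big_const_ord iter_addn_0 mul1n.
have szT : (size (betheT 1 p hbar z) <= n.+1)%N.
  by rewrite TE -szP size_poly.
rewrite (horner_scalarE _ szT); apply: memv_suml => i _; apply: memvZ.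
case: (ltnP i n) => [i_n|n_i].
  have -> : (betheT 1 p hbar z)`_i = bethe_coef 1 (n - i) p hbar z.
    by rewrite /bethe_coef subKn // ltnW.
  by apply: bethe_coef_in; rewrite ?n1 // subn_gt0 i_n leq_subr.
have -> : i = n :> nat by apply/anti_leq; rewrite n_i -ltnS ltn_ord.
rewrite TE coef_TrP (_ : P`_n = 1) ?Tr1.
  by rewrite memvZ // (subvP (sub1_agenv _)) // memv_line.
have := monic_prod_XsubC site_seq xpredT c => /monicP.
by rewrite lead_coefE -/P szP.
Qed.

Lemma bethe_alg_comm a x : x \in bethe_alg p hbar z -> GRing.comm x (hamiltonian a).
Proof.
suff: (bethe_alg p hbar z <= 'C[hamiltonian a])%VS.
  by move=> /subvP h /h /cent1vP.
apply: agenv_sub_aspace; first exact: cent1v1.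
apply/span_subvP => y.
case/allpairsP => -[m i] [_ _ ->] /=; apply/cent1vP/esym; exact: hamiltonian_comm.
Qed.

End Hamiltonians.

(** * The inner product of the group algebra *)

Section InnerProduct.
Variables (C : numClosedFieldType) (n : nat).
Local Notation A := (symalg C n).
Implicit Types (x y u w : A) (s t g h : 'S_n) (S : {set 'I_n}).

(** The adjoint for [form]: it is antilinear and inverts permutations. *)
Definition star x : A := [ffun s => (x s^-1%g)^*].
Definition form x y : C := \sum_s (x s)^* * y s.

Lemma form_is_linear x : linear (form x : A -> C^o).
Proof.
move=> k y1 y2; rewrite /form scaler_sumr -big_split; apply: eq_bigr => s _ /=.
by rewrite !ffunE mulrDr mulrCA.
Qed.
HB.instance Definition _ x :=
  GRing.isLinear.Build C A C^o _ (form x) (form_is_linear x).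

Lemma formZl k x y : form (k *: x) y = k^* * form x y.
Proof.
rewrite /form mulr_sumr; apply: eq_bigr => s _.
by rewrite ffunE rmorphM mulrA.
Qed.

Lemma formBl x1 x2 y : form (x1 - x2) y = form x1 y - form x2 y.
Proof.
rewrite /form -sumrB; apply: eq_bigr => s _.
by rewrite !ffunE rmorphB mulrBl.
Qed.

Lemma form_suml (I : Type) (r : seq I) (P : pred I) (f : I -> A) y :
  form (\sum_(i <- r | P i) f i) y = \sum_(i <- r | P i) form (f i) y.
Proof.
rewrite /form exchange_big; apply: eq_bigr => s _ /=.
by rewrite sum_ffunE rmorph_sum mulr_suml.
Qed.

Lemma form_ge0 x : 0 <= form x x.
Proof. by apply: sumr_ge0 => s _; rewrite mulrC mul_conjC_ge0. Qed.

Lemma form_eq0 x : form x x = 0 -> x = 0.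
Proof.
move/eqP; rewrite /form psumr_eq0 => [|s _]; last by rewrite mulrC mul_conjC_ge0.
move=> /allP x0; apply/ffunP => s; rewrite ffunE; apply/eqP.
by have := x0 s (mem_index_enum _); rewrite mulrC mul_conjC_eq0.
Qed.

Lemma form_mull u x y : form (u * x) y = form x (star u * y).
Proof.
rewrite /form; under eq_bigr do rewrite mul_coefE rmorph_sum mulr_suml.
under [RHS]eq_bigr do rewrite mul_coefE mulr_sumr.
rewrite exchange_big [RHS]exchange_big [RHS](reindex_inj invg_inj) /=.
apply: eq_bigr => g _; rewrite (reindex_inj (mulIg g)) /=.
apply: eq_bigr => s _; rewrite ffunE invgK mulgK rmorphM.
by rewrite mulrAC mulrC mulrCA mulrA.
Qed.

Lemma form_mulr u x y : form (x * u) y = form x (y * star u).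
Proof.
rewrite /form; under eq_bigr do rewrite mul_coefE_inv rmorph_sum mulr_suml.
under [RHS]eq_bigr do rewrite mul_coefE_inv mulr_sumr.
rewrite exchange_big [RHS]exchange_big [RHS](reindex_inj invg_inj) /=.
apply: eq_bigr => g _; rewrite (reindex_inj (mulgI g)) /=.
apply: eq_bigr => s _; rewrite ffunE invgK mulKg rmorphM.
by rewrite -mulrA; congr (_ * _); rewrite mulrC.
Qed.

Lemma starD x y : star (x + y) = star x + star y.
Proof. by apply/ffunP => s; rewrite !ffunE rmorphD. Qed.

Lemma starZ k x : star (k *: x) = k^* *: star x.
Proof. by apply/ffunP => s; rewrite !ffunE rmorphM. Qed.

Lemma starM x y : star (x * y) = star y * star x.
Proof.
apply/ffunP => s; rewrite ffunE mul_coefE rmorph_sum mul_coefE_inv.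
rewrite [RHS](reindex_inj invg_inj) /=; apply: eq_bigr => g _.
by rewrite !ffunE rmorphM !invgK invMg mulrC.
Qed.

Lemma starK x : star (star x) = x.
Proof. by apply/ffunP => s; rewrite !ffunE invgK conjCK. Qed.

Lemma star_symb s : star (symb C s) = symb C s^-1%g.
Proof. by apply/ffunP => t; rewrite !ffunE rmorph_nat (can2_eq invgK invgK). Qed.

Lemma star1 : star 1 = 1.
Proof. by rewrite -symb1 star_symb invg1. Qed.

Lemma star_sum (I : Type) (r : seq I) (P : pred I) (f : I -> A) :
  star (\sum_(i <- r | P i) f i) = \sum_(i <- r | P i) star (f i).
Proof.
apply: (big_morph _ starD); apply/ffunP => s; by rewrite !ffunE rmorph0.
Qed.

(** Pairing with a basis of [W] embeds [K] in a space of dimension [\dim W].  Used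
    with [W] contained in [K], this replaces orthogonal projections. *)
Lemma dim_le_orth (W K : {vspace A}) :
  (forall y, y \in K -> {in W, forall w, form w y = 0} -> y = 0) ->
  (\dim K <= \dim W)%N.
Proof.
move=> orth; pose f y : 'rV[C]_(\dim W) := \row_i form (vbasis W)`_i y.
have f_lin : linear f.
  by move=> k y1 y2; apply/rowP => i; rewrite !mxE linearP.
pose fL := GRing.isLinear.Build _ _ _ _ f f_lin.
pose phi := linfun (HB.pack f fL : {linear A -> 'rV[C]_(\dim W)}).
have phiE y : phi y = f y by rewrite lfunE.
rewrite -(limg_ker_dim phi K) (_ : (K :&: lker phi = 0)%VS) ?dimv0 ?add0n.
  apply: leq_trans (dimvS (subvf _)) _.
  by rewrite dimvf /dim /= mul1n.
apply/eqP; rewrite -subv0; apply/subvP => y /memv_capP[yK].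
rewrite memv_ker phiE => /eqP/rowP y0; rewrite memv0; apply/eqP/orth => // w.
move=> /coord_vbasis ->; rewrite form_suml big1 // => i _.
by have := y0 i; rewrite !mxE formZl => ->; rewrite mulr0.
Qed.

End InnerProduct.

(** * Maximal commutativity propagates *)

Section Averaging.
Variables (C : numClosedFieldType) (n : nat) (S : {set 'I_n}).
Local Notation A := (symalg C n).
Implicit Types (x y u w c : A) (s t g h : 'S_n).

Local Notation AS := (symalg_on C S).

Definition avg x : A := \sum_(g in Sym S) symb C g * x * symb C g^-1%g.

Lemma avg_is_linear : linear avg.
Proof.
move=> k x y; rewrite /avg scaler_sumr -big_split; apply: eq_bigr => g _ /=.
by rewrite mulrDr mulrDl -scalerAr -scalerAl.
Qed.
HB.instance Definition _ := GRing.isLinear.Build C A A _ avg avg_is_linear.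

Lemma symbK g x : symb C g^-1%g * (symb C g * x) = x.
Proof. by rewrite mulrA symbM mulgV symb1 mul1r. Qed.

Lemma symbKV g x : x * symb C g * symb C g^-1%g = x.
Proof. by rewrite -mulrA symbM mulVg symb1 mulr1. Qed.

Lemma symbVK g x : x * symb C g^-1%g * symb C g = x.
Proof. by rewrite -mulrA symbM mulgV symb1 mulr1. Qed.

Lemma conj_symbM g h x : symb C (g * h)%g * x * symb C (g * h)^-1%g =
  symb C h * (symb C g * x * symb C g^-1%g) * symb C h^-1%g.
Proof.
rewrite invMg -!symbM; move: (symb C g) (symb C h) (symb C _) (symb C _).
by move=> a b c d; rewrite !mulrA.
Qed.

Lemma conj_symbMV g h x :
  symb C (g * h)%g * x * symb C (g * h)^-1%g * symb C h =
  symb C h * (symb C g * x * symb C g^-1%g).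
Proof. by rewrite conj_symbM symbVK. Qed.

Lemma conj_symb_rotate g x :
  symb C g * x = symb C g * (x * symb C g) * symb C g^-1%g.
Proof. by rewrite mulrA symbKV. Qed.

Lemma comm_symalg_on (x : A) :
  (forall g, g \in Sym S -> symb C g * x = x * symb C g) -> x \in 'C(AS)%VS.
Proof.
move=> com; apply/centvP => y; rewrite (symalg_sum y) => /symalg_onP yS.
rewrite mulr_sumr mulr_suml; apply: eq_bigr => g _.
rewrite -scalerAr -scalerAl; case: (boolP (perm_on S g)) => gS.
  by rewrite com // inE.
by have := yS g gS; rewrite -symalg_sum => ->; rewrite !scale0r.
Qed.

Lemma avg_comm x : avg x \in 'C(AS)%VS.
Proof.
apply: comm_symalg_on => h hS; rewrite /avg mulr_sumr mulr_suml.
rewrite [RHS](reindex_inj (mulIg h)) /=; apply: eq_big => [g|g gS].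
  by rewrite groupMr.
exact/esym/conj_symbMV.
Qed.

Lemma avg_conj g x : g \in Sym S -> avg (symb C g * x * symb C g^-1%g) = avg x.
Proof.
move=> gS; rewrite /avg [RHS](reindex_inj (mulgI g)) /=; apply: eq_big => [h|h hS].
  by rewrite groupMl.
exact/esym/conj_symbM.
Qed.

(** For [a] a permutation the two arguments are conjugate by [a]. *)
Lemma avg_mulC a x : a \in AS -> avg (a * x) = avg (x * a).
Proof.
move=> /symalg_onP aS; rewrite (symalg_sum a) mulr_suml mulr_sumr !linear_sum.
apply: eq_bigr => g _; rewrite -scalerAl -scalerAr !linearZ /=.
case: (boolP (perm_on S g)) => [gS|/aS ->]; last by rewrite !scale0r.
have gS' : g \in Sym S by rewrite inE.
congr (_ *: _); apply: etrans (avg_conj (x * symb C g) gS').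
congr (avg _); exact/conj_symb_rotate.
Qed.

Lemma avg_fix x : x \in 'C(AS)%VS -> avg x = #|Sym S|%:R *: x.
Proof.
move=> /centvP xS; rewrite /avg (eq_bigr (fun _ => x)) => [|g gS].
  by rewrite sumr_const scaler_nat.
by rewrite -xS ?symbKV // symb_on //; move: gS; rewrite inE.
Qed.

Lemma avg_mull c x : c \in 'C(AS)%VS -> avg (c * x) = c * avg x.
Proof.
move=> /centvP cS; rewrite /avg mulr_sumr; apply: eq_bigr => g gS.
by rewrite !mulrA cS // symb_on //; move: gS; rewrite inE.
Qed.

Lemma form_avg c x : c \in 'C(AS)%VS -> form c (avg x) = #|Sym S|%:R * form c x.
Proof.
move=> /centvP cS; rewrite /avg linear_sum /= (eq_bigr (fun _ => form c x)).
  by rewrite sumr_const mulr_natl.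
move=> g gS; have {gS} gS : symb C g \in AS by apply: symb_on; move: gS; rewrite inE.
have move_l u : form c (symb C g * u) = form (symb C g^-1%g * c) u.
  by rewrite form_mull star_symb invgK.
have move_r w u : form w (u * symb C g^-1%g) = form (w * symb C g) u.
  by rewrite form_mulr star_symb.
by rewrite -mulrA move_l move_r -mulrA cS // symbK.
Qed.

Lemma avg_on (S' : {set 'I_n}) x : S \subset S' -> x \in symalg_on C S' ->
  avg x \in symalg_on C S'.
Proof.
move=> SS' xS'; apply: memv_suml => g gS.
have gS' : perm_on S' g by apply: perm_onS SS' _; move: gS; rewrite inE.
by rewrite !symalg_onM // symb_on // perm_onV.
Qed.

Lemma avg_symb_central g : g \in Sym S -> avg (symb C g) \in ('Z(AS))%VS.
Proof.
move=> gS; apply/memv_capP; split; last exact: avg_comm.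
by apply: avg_on => //; apply: symb_on; move: gS; rewrite inE.
Qed.

Lemma star_avg g : star (avg (symb C g)) = avg (symb C g^-1%g).
Proof.
rewrite /avg star_sum; apply: eq_bigr => h _.
by rewrite !starM !star_symb invgK mulrA.
Qed.

End Averaging.

Section Peeling.
Variables (C : numClosedFieldType) (n : nat) (S S' : {set 'I_n}).
Local Notation A := (symalg C n).
Local Notation AS := (symalg_on C S).
Local Notation AS' := (symalg_on C S').
Variable (J : {aspace A}).
Hypotheses (SS' : S \subset S') (JS : (J <= AS)%VS).
Hypothesis (J_comm : (J <= 'C(J))%VS).
Hypothesis (J_star : {in J, forall x, star x \in J}).
Hypothesis (J_max : (AS :&: 'C(J) <= J)%VS).
Implicit Types (x y u w c : A) (s t g h : 'S_n).

(** The average [c] of [j * y] commutes with [AS], so that, up to a factor, pairing [c] with itself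
    amounts to pairing [star j * c], an element of the product space, with [y]. *)
Lemma avg_orth y : y \in AS' -> y \in 'C(J)%VS ->
  {in (J * (AS' :&: 'C(AS)))%VS, forall w, form w y = 0} ->
  {in J, forall j, avg S (j * y) = 0}.
Proof.
move=> yS' yJ orth j jJ; apply: form_eq0; set c := avg S _.
have cC : c \in 'C(AS)%VS by apply: avg_comm.
have jS' : j \in AS' by apply: (subvP (symalg_onS _ SS')); apply: (subvP JS).
have cS' : c \in AS' by apply: avg_on => //; apply: symalg_onM.
rewrite {2}/c form_avg // -[j]starK -form_mull orth ?mulr0 //.
by rewrite memv_mul ?J_star // memv_cap cS'.
Qed.

(** [AS] is spanned by [J] and the commutators of its elements with [J], since an
    element orthogonal to all these commutators commutes with [J] and so belongs
    to [J]; and the average of [x * y] vanishes when [x] is a commutator with an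
    element of [J], which commutes with [y]. *)
Lemma avg_orth_on y : y \in 'C(J)%VS ->
  {in J, forall j, avg S (j * y) = 0} -> {in AS, forall x, avg S (x * y) = 0}.
Proof.
move=> /centvP yJ avgJ.
pose phi : 'End(A) := (linfun (avg S) \o amulr y)%VF.
have phiE x : phi x = avg S (x * y) by rewrite comp_lfunE !lfunE.
suff: (AS <= AS :&: lker phi)%VS.
  by move/subvP=> sub x /sub /memv_capP[_]; rewrite memv_ker phiE => /eqP.
suff: (\dim AS <= \dim (AS :&: lker phi))%N.
  by move=> le_dim; rewrite -(geq_leqif (dimv_leqif_sup (capvSl AS (lker phi)))).
apply: dim_le_orth => u uS orth.
suff uJ : u \in J.
  by apply/form_eq0/orth; rewrite memv_cap uS memv_ker phiE avgJ ?eqxx.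
apply: (subvP J_max); rewrite memv_cap uS; apply/centvP => x xJ.
have xS := subvP JS x xJ; have x'S := subvP JS _ (J_star xJ).
apply/eqP; rewrite -subr_eq0; apply/eqP; set v := _ - _.
have vS : v \in AS by rewrite memvB // symalg_onM.
apply: form_eq0; have : form (star x * v - v * star x) u = 0.
  apply: orth; rewrite memv_cap memvB ?symalg_onM //= memv_ker phiE.
  rewrite mulrBl linearB /= -!mulrA avg_mulC // -mulrA yJ ?J_star //.
  by rewrite subrr.
rewrite formBl form_mull form_mulr !starK -linearB /= -opprB linearN /=.
by move/eqP; rewrite oppr_eq0 => /eqP.
Qed.

(** The sum of all group commutators [h g h^-1 g^-1].  It acts on each irreducible
    representation by a positive scalar; [commutator_sumE] is the form of this
    fact that avoids representations. *)
Definition commutator_sum : A :=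
  \sum_(g in Sym S) avg S (symb C g) * symb C g^-1%g.

Lemma commutator_sum_central : commutator_sum \in 'C(AS)%VS.
Proof.
apply: comm_symalg_on => k kS; rewrite /commutator_sum mulr_sumr mulr_suml.
rewrite [RHS](reindex_inj (conjg_inj k)) /=; apply: eq_big => [g|g gS].
  by rewrite groupJr.
have /centvP aC := avg_comm S (symb C g).
have -> : avg S (symb C (g ^ k)%g) = avg S (symb C g).
  by rewrite -[RHS](avg_conj _ kS) !symbM mulgA conjgE mulgA.
rewrite mulrA -aC ?symb_on //; last by move: kS; rewrite inE.
by rewrite -!mulrA !symbM -conjVg conjgE !mulgA mulgV mul1g.
Qed.

Lemma commutator_sumE : #|Sym S|%:R *: commutator_sum =
  \sum_(g in Sym S) avg S (symb C g) * star (avg S (symb C g)).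
Proof.
rewrite -(avg_fix commutator_sum_central) linear_sum; apply: eq_bigr => g gS /=.
by rewrite avg_mull ?avg_comm // star_avg.
Qed.

(** Summing the vanishing averages of [h^-1 * y], multiplied by [h], gives [y]
    times the sum of the commutators.  That sum is, up to a positive factor, a sum
    of elements [a * star a], one of which is a nonzero scalar. *)
Lemma avg_orth_eq0 y : y \in 'C(J)%VS ->
  {in AS, forall x, avg S (x * y) = 0} -> y = 0.
Proof.
move=> /centvP yJ avg0.
have aJ g : g \in Sym S -> avg S (symb C g) \in J.
  move=> gS; apply: (subvP J_max); have := avg_symb_central C gS.
  rewrite !memv_cap => /andP[-> /centvP aC]; apply/centvP => x xJ.
  by apply: aC; apply: (subvP JS).
have y_comm : y * commutator_sum = 0.
  transitivity (\sum_(h in Sym S) symb C h * avg S (symb C h^-1%g * y)).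
    rewrite /commutator_sum mulr_sumr.
    under [RHS]eq_bigr do rewrite /avg mulr_sumr.
    rewrite [RHS]exchange_big /=; apply: eq_bigr => g gS.
    rewrite mulrA yJ ?aJ // -mulrA /avg mulr_suml; apply: eq_bigr => h _.
    by rewrite -!mulrA.
  rewrite big1 // => h hS; rewrite avg0 ?mulr0 // symb_on //.
  by rewrite perm_onV; move: hS; rewrite inE.
have sum0 : \sum_(g in Sym S) form (y * avg S (symb C g)) (y * avg S (symb C g)) = 0.
  transitivity (form y (y * (#|Sym S|%:R *: commutator_sum))).
    rewrite commutator_sumE mulr_sumr linear_sum; apply: eq_bigr => g gS /=.
    by rewrite form_mulr mulrA.
  by rewrite -scalerAr y_comm scaler0 linear0.
move/eqP: sum0; rewrite psumr_eq0 => [|g _]; last exact: form_ge0.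
move=> /allP/(_ 1%g (mem_index_enum _)); rewrite group1 /= => /eqP/form_eq0.
rewrite symb1 avg_fix; last by apply/centvP => x _; rewrite mul1r mulr1.
rewrite mulr_algr => /eqP; rewrite scaler_eq0 pnatr_eq0 => /orP[|/eqP//].
by rewrite -leqn0 leqNgt cardG_gt0.
Qed.

(** In representation terms: [J] is diagonal with simple spectrum on the
    irreducible representations of [Sym S], so an element that commutes with it is
    diagonal on each of them and acts arbitrarily on their multiplicity spaces.
    The proof shows that an element of the left side that is orthogonal to the
    right side is [0]. *)
Lemma centraliser_peel : (AS' :&: 'C(J) <= J * (AS' :&: 'C(AS)))%VS.
Proof.
set K := (AS' :&: 'C(J))%VS; set W := (J * _)%VS.
have JAS' : (J <= AS')%VS := subv_trans JS (symalg_onS C SS').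
have WK : (W <= K)%VS.
  rewrite subv_cap; apply/andP; split.
    by apply: (@prodv_sub _ _ _ _ [aspace of AS']) => //; exact: capvSl.
  apply: (@prodv_sub _ _ _ _ [aspace of 'C(J)]) => //.
  apply: subv_trans (capvSr _ _) _; apply/subvP => x /centvP xS.
  by apply/centvP => j jJ; apply/xS/(subvP JS).
rewrite -(geq_leqif (dimv_leqif_sup WK)).
apply: dim_le_orth => y /memv_capP[yS' yJ] orth.
exact/(avg_orth_eq0 yJ)/(avg_orth_on yJ)/(avg_orth yS' yJ).
Qed.

End Peeling.

(** * Jucys-Murphy elements and the Gelfand-Zetlin algebra *)

Lemma agenv_ind (K : fieldType) (E : falgType K) (P : E -> Prop) (X : seq E) :
  (forall x y, P x -> P y -> P (x + y)) -> (forall k x, P x -> P (k *: x)) ->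
  (forall x y, P x -> P y -> P (x * y)) -> P 1 -> {in X, forall x, P x} ->
  {in agenv <<X>>%VS, forall x, P x}.
Proof.
move=> PD PZ PM P1 PX x.
have P0 : P 0 by rewrite -[0](scale0r 1); apply: PZ.
have Psum (I : Type) (r : seq I) (f : I -> E) : (forall i, P (f i)) ->
    P (\sum_(i <- r) f i).
  by move=> Pf; apply: big_ind.
have Pspan (Y : seq E) : {in Y, forall y, P y} -> {in <<Y>>%VS, forall y, P y}.
  move=> PY y /(coord_span (X := in_tuple Y)) ->; apply: Psum => i; apply: PZ.
  by apply: PY; apply: mem_nth; apply: ltn_ord.
case/memv_sumP => f fU ->; apply: Psum => i.
elim: (i : nat) (f i) (fU i isT) => {fU} [y|k IH y].
  by rewrite expv0 => /vlineP[c ->]; apply: PZ.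
rewrite expvSl unlock; apply: (Pspan _ _) => _ /allpairsP[[u v] [/= uU vU ->]].
apply: PM; last by apply: IH; apply: vbasis_mem.
by apply: (Pspan _ PX); apply: vbasis_mem.
Qed.

Definition jucys_murphy (F : fieldType) n (a : 'I_n) : symalg F n :=
  \sum_(b < n | (b < a)%N) symb F (tperm b a).

Section JucysMurphy.
Variables (C : numClosedFieldType) (n : nat).
Local Notation A := (symalg C n).
Implicit Types (x y : A) (s t g h : 'S_n) (a b : 'I_n).

Definition pts m : {set 'I_n} := [set i : 'I_n | (i < m)%N].

Local Notation jm := (@jucys_murphy C n).

Definition jm_alg m : {aspace A} :=
  << <<[seq jm a | a <- enum 'I_n & (a < m)%N]>> >>%AS.

Lemma ptsS m1 m2 : (m1 <= m2)%N -> pts m1 \subset pts m2.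
Proof.
by move=> le_m; apply/fintype.subsetP => i; rewrite !inE => /leq_trans; apply.
Qed.

Lemma jm_alg1 m : 1 \in jm_alg m.
Proof. by rewrite (subvP (sub1_agenv _)) // memv_line. Qed.

Lemma jm_in m a : (a < m)%N -> jm a \in jm_alg m.
Proof.
move=> am; apply: (subvP (sub_agenv _)); apply/memv_span/map_f.
by rewrite mem_filter am mem_enum.
Qed.

Lemma jm_alg_sub m (B : {aspace A}) :
  1 \in B -> (forall a, (a < m)%N -> jm a \in B) -> (jm_alg m <= B)%VS.
Proof.
move=> B1 jB; apply: agenv_sub_aspace => //; apply/span_subvP => y.
by case/mapP => a; rewrite mem_filter => /andP[am _] ->; apply: jB.
Qed.

Lemma jm_algS m : (jm_alg m <= jm_alg m.+1)%VS.
Proof.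
by apply: jm_alg_sub => [|a am]; [exact: jm_alg1|apply: jm_in; exact: ltnW].
Qed.

Lemma jm_on m a : (a < m)%N -> jm a \in symalg_on C (pts m).
Proof.
move=> am; apply: memv_suml => b ba; apply: symb_tperm_on; rewrite inE //.
exact: ltn_trans ba am.
Qed.

Lemma jm_alg_on m : (jm_alg m <= symalg_on C (pts m))%VS.
Proof.
apply: (@jm_alg_sub m [aspace of symalg_on C (pts m)]) => [|a].
  exact: symalg_on1.
exact: jm_on.
Qed.

Lemma jm_comm_on a : jm a \in 'C(symalg_on C (pts a))%VS.
Proof.
apply: comm_symalg_on => g; rewrite inE => ga.
have g_a : g a = a by apply: out_perm ga _; rewrite inE ltnn.
rewrite /jucys_murphy mulr_sumr mulr_suml [RHS](reindex_inj (@perm_inj _ g)) /=.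
apply: eq_big => [b|b _]; first by have := perm_closed b ga; rewrite !inE.
by rewrite symb_tperm g_a.
Qed.

Lemma jm_comm a b : GRing.comm (jm a) (jm b).
Proof.
wlog : a b / (a <= b)%N.
  by move=> W; case/orP: (leq_total a b) => [|ba]; [exact: W|apply/esym/W].
rewrite leq_eqVlt => /orP[/eqP/val_inj -> //|ab].
by have /centvP com := jm_comm_on b; apply/esym/com/jm_on.
Qed.

Lemma jm_alg_comm m : (jm_alg m <= 'C(jm_alg m))%VS.
Proof.
apply: (@jm_alg_sub m [aspace of 'C(jm_alg m)]) => [|a am].
  exact: centv1.
rewrite -subv_cent1; apply: (@jm_alg_sub m [aspace of 'C[jm a]]) => [|b bm].
  exact: cent1v1.
by apply/cent1vP; exact: jm_comm.
Qed.

Lemma jm_alg_star m : {in jm_alg m, forall x, star x \in jm_alg m}.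
Proof.
apply: agenv_ind => [x y|k x|x y||x].
- by rewrite starD; exact: memvD.
- by rewrite starZ; exact: memvZ.
- by rewrite starM => xJ yJ; exact: memvM.
- by rewrite star1 jm_alg1.
case/mapP => a; rewrite mem_filter => /andP[am _] ->.
rewrite /jucys_murphy star_sum (_ : \sum_(b < n | _) _ = jm a) ?jm_in //.
by apply: eq_bigr => b _; rewrite star_symb tpermV.
Qed.

Definition moved s : {set 'I_n} := [set i | s i != i].

(** The permutation [s'] is [s] with the point [j] before [a] cut out of the cycle
    of [a].  In [jm a] times the average of [s'], the transpositions of [a] with
    points fixed by [s'] all give the average of [s], and the other ones give
    averages of permutations that move fewer points than [s]. *)
Lemma avg_in_jm a s : ('Z(symalg_on C (pts a)) <= jm_alg a)%VS ->
  perm_on (pts a.+1) s -> avg (pts a) (symb C s) \in jm_alg a.+1.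
Proof.
move=> ZJ; have [k] := ubnP #|moved s|; elim: k s => // k IH s.
rewrite ltnS => s_k sa.
have [sa_fix|sa_mv] := eqVneq (s a) a.
  apply: (subvP (jm_algS a)); apply/(subvP ZJ)/avg_symb_central; rewrite inE.
  apply/fintype.subsetP => i; rewrite inE => i_mv.
  have := out_perm sa; move=> /(_ i); rewrite !inE ltnS => out.
  rewrite ltn_neqAle; apply/andP; split.
    by apply: contraNneq i_mv => /val_inj ->; rewrite sa_fix.
  by apply: contraR i_mv => /out ->.
pose j := (s^-1)%g a; have s_j : s j = a by rewrite permKV.
have ja : j != a by apply: contraNneq sa_mv => ja; rewrite -{1}ja s_j.
have a_on : a \in pts a.+1 by rewrite inE.
have j_lt : (j < a)%N.
  have : j \in pts a.+1 by rewrite -(perm_closed _ sa) s_j.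
  by rewrite inE ltnS leq_eqVlt => /orP[/eqP/val_inj e|//]; rewrite e eqxx in ja.
pose s' := (s * tperm j a)%g.
have s'_j : s' j = j by rewrite permM s_j tpermR.
have s'_fix i : s i = i -> s' i = i.
  move=> si; rewrite permM si tpermD //.
    by apply: contraNneq ja => ji; rewrite -s_j ji si.
  by apply: contraNneq sa_mv => ->; rewrite si.
have shorter t : perm_on (pts a.+1) t -> t j = j ->
    (forall i, s i = i -> t i = i) -> avg (pts a) (symb C t) \in jm_alg a.+1.
  move=> ta tj tfix; apply: IH => //; apply: leq_trans s_k.
  apply: proper_card; apply/fintype.properP; split.
    by apply/fintype.subsetP => i; rewrite !inE; apply: contraNneq => /tfix ->.
  by exists j; rewrite !inE ?tj ?eqxx // s_j eq_sym.
have tperm_a b : (b < a)%N -> perm_on (pts a.+1) (tperm b a).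
  move=> ba; apply: (perm_onS _ (tperm_on b a)); apply/fintype.subsetP => c.
  by case/set2P => ->; rewrite inE // ltnS ltnW.
have s'a : perm_on (pts a.+1) s' by apply: perm_onM => //; apply: tperm_a.
have s'J := shorter s' s'a s'_j s'_fix.
have step : jm a * avg (pts a) (symb C s') =
    \sum_(b < n | (b < a)%N) avg (pts a) (symb C (s' * tperm b a)%g).
  rewrite -avg_mull ?jm_comm_on // /jucys_murphy mulr_suml linear_sum.
  by apply: eq_bigr => b _; rewrite symbM.
(* The transposition of [b] and [j] fixes [a] and commutes with [s']. *)
have free b : (b < a)%N -> s' b = b ->
    avg (pts a) (symb C (s' * tperm b a)%g) = avg (pts a) (symb C s).
  move=> ba s'b.
  have gS : tperm b j \in Sym (pts a).
    rewrite inE; apply: (perm_onS _ (tperm_on b j)); apply/fintype.subsetP => c.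
    by case/set2P => ->; rewrite inE.
  have us' : (tperm b j * s' = s' * tperm b j)%g by rewrite conjgC tpermJ s'b s'_j.
  have sE : s = (s' * tperm j a)%g by rewrite /s' -mulgA tperm2 mulg1.
  have uE : tperm b j a = a.
    by rewrite tpermD //; apply: contraTneq ba => ->; rewrite ltnn.
  rewrite -[RHS](avg_conj _ gS) !symbM -conjgE sE conjMg tpermJ uE tpermR.
  by rewrite [(s' ^ _)%g]conjgE -us' mulKg.
rewrite (bigID (fun b => s' b == b)) /= in step.
have JE : #|[pred b : 'I_n | (b < a)%N & s' b == b]|%:R *: avg (pts a) (symb C s)
    \in jm_alg a.+1.
  rewrite scaler_nat -sumr_const.
  rewrite (_ : \sum_(b in _) _ = jm a * avg (pts a) (symb C s') -
    \sum_(b < n | (b < a)%N && (s' b != b)) avg (pts a) (symb C (s' * tperm b a)%g)).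
    rewrite memvB ?memvM ?jm_in //; apply: memv_suml => b /andP[ba s'b].
    apply: shorter; first by apply: perm_onM => //; exact: tperm_a.
      rewrite permM s'_j tpermD //; last by rewrite eq_sym.
      by apply: contraNneq s'b => ->; rewrite s'_j.
    move=> i si; rewrite permM s'_fix // tpermD //.
      by apply: contraNneq s'b => ->; rewrite s'_fix.
    by apply: contraNneq sa_mv => ->; rewrite si.
  rewrite step addrK; apply: eq_bigr => b; rewrite inE /= => /andP[ba /eqP s'b].
  by rewrite free.
rewrite -[avg _ _](@scalerK _ _ #|[pred b : 'I_n | (b < a)%N & s' b == b]|%:R).
  by rewrite memvZ.
rewrite pnatr_eq0 -lt0n; apply/card_gt0P; exists j.
by rewrite inE /= j_lt s'_j eqxx.
Qed.

(** An element that commutes with the permutations of [pts a] is a multiple of its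
    own average. *)
Lemma centraliser_succ a : ('Z(symalg_on C (pts a)) <= jm_alg a)%VS ->
  (symalg_on C (pts a.+1) :&: 'C(symalg_on C (pts a)) <= jm_alg a.+1)%VS.
Proof.
move=> ZJ; apply/subvP => x /memv_capP[/symalg_onP xa x_comm].
rewrite -[x](@scalerK _ _ #|Sym (pts a)|%:R); last first.
  by rewrite pnatr_eq0 -lt0n cardG_gt0.
rewrite memvZ // -avg_fix // [in avg _ _](symalg_sum x) linear_sum.
apply: memv_suml => s _; rewrite linearZ /=.
case: (boolP (perm_on (pts a.+1) s)) => [sa|/xa ->]; last first.
  by rewrite scale0r mem0v.
by rewrite memvZ // avg_in_jm.
Qed.

(** One point is added at a time: by [centraliser_peel] it is enough to know the
    elements that commute with all permutations of the previous points, and the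
    induction hypothesis puts the centre of the previous group algebra in
    [jm_alg m], as [centraliser_succ] requires. *)
Lemma jm_alg_max m : (m <= n)%N ->
  (symalg_on C (pts m) :&: 'C(jm_alg m) <= jm_alg m)%VS.
Proof.
elim: m => [_|m IH m_n].
  apply/subvP => x /memv_capP[/symalg_onP x0 _]; rewrite (symalg_sum x).
  apply: memv_suml => s _; case: (boolP (perm_on (pts 0) s)) => [s0|/x0 ->].
    rewrite (_ : s = 1%g) ?symb1 ?memvZ ?jm_alg1 //.
    by apply/permP => i; rewrite perm1; apply: out_perm s0 _; rewrite inE.
  by rewrite scale0r mem0v.
have {}IH := IH (ltnW m_n); pose a := Ordinal m_n.
have ZJ : ('Z(symalg_on C (pts a)) <= jm_alg a)%VS.
  apply: subv_trans IH; apply: capvS => //; apply/subvP => x /centvP xS.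
  by apply/centvP => y yJ; apply/xS/(subvP (jm_alg_on m)).
apply: subv_trans (_ : (jm_alg m * jm_alg m.+1 <= _)%VS); last first.
  by apply: prodv_sub => //; apply: jm_algS.
apply: subv_trans (prodvSr _ (centraliser_succ ZJ)).
have peel := centraliser_peel (ptsS (leqnSn m)) (jm_alg_on m)
  (@jm_alg_comm m) (@jm_alg_star m) IH.
apply: subv_trans peel.
apply: capvS => //; apply/subvP => x /centvP xJ.
by apply/centvP => y yJ; apply/xJ/(subvP (jm_algS m)).
Qed.

Lemma centraliser_jm : ('C(jm_alg n) <= jm_alg n)%VS.
Proof.
apply: subv_trans (jm_alg_max (leqnn n)); rewrite subv_cap subvv andbT.
apply/subvP => x _; apply/symalg_onP => s /negP[].
by apply/fintype.subsetP => i _; rewrite inE.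
Qed.

(** Twice the sum of the transpositions of [pts m], up to a constant.  Summing over
    all ordered pairs makes the invariance under relabelling evident. *)
Definition pair_sum m : A :=
  \sum_(b in pts m) \sum_(c in pts m) symb C (tperm b c).

Lemma pair_sum_central m : pair_sum m \in 'Z(symalg_on C (pts m))%VS.
Proof.
apply/memv_capP; split.
  apply: memv_suml => b bm; apply: memv_suml => c cm; exact: symb_tperm_on.
apply: comm_symalg_on => g gm; rewrite /pair_sum mulr_sumr mulr_suml.
have g_pts b : (g b \in pts m) = (b \in pts m).
  by apply: perm_closed; move: gm; rewrite inE.
rewrite [RHS](reindex_inj (@perm_inj _ g)) /=; apply: eq_big => [b|b _] //.
rewrite mulr_sumr mulr_suml [RHS](reindex_inj (@perm_inj _ g)) /=.
by apply: eq_big => [c|c _] //; rewrite symb_tperm.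
Qed.

Lemma jm_pair_sum a : pair_sum a.+1 = pair_sum a + 2%:R *: jm a + 1.
Proof.
have split_pts (f : 'I_n -> A) :
    \sum_(b in pts a.+1) f b = \sum_(b in pts a) f b + f a.
  rewrite (bigD1 a) ?inE //= addrC; congr (_ + _); apply: eq_bigl => b.
  by rewrite !inE ltnS ltn_neqAle andbC.
rewrite /pair_sum split_pts; under eq_bigr do rewrite split_pts.
rewrite big_split /= split_pts tperm1 symb1 -!addrA; congr (_ + _).
rewrite addrA; congr (_ + _); rewrite scaler_nat mulr2n; congr (_ + _).
  by apply: eq_bigl => b; rewrite inE.
by apply: eq_big => [b|b _]; rewrite ?inE // tpermC.
Qed.

(** The centres commute with all Jucys-Murphy elements, hence belong to [jm_alg n],
    which is its own centraliser; conversely a Jucys-Murphy element is a difference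
    of two central sums of transpositions. *)
Lemma gelfand_zetlin_jm : gelfand_zetlin C n = jm_alg n :> {vspace A}.
Proof.
have GZ1 : 1 \in gelfand_zetlin C n.
  by rewrite (subvP (sub1_agenv _)) // memv_line.
apply/eqP; rewrite eqEsubv; apply/andP; split.
  apply: agenv_sub_aspace; first exact: jm_alg1.
  apply/subv_sumP => m _; apply: subv_trans centraliser_jm.
  rewrite centvC; apply: (@jm_alg_sub n [aspace of 'C('Z(sub_symalg C n m.+1))]).
    exact: centv1.
  move=> a _; apply/centvP => x /memv_capP[xm /centvP x_comm].
  have [am|ma] := leqP a m; first by rewrite x_comm // jm_on.
  have /centvP -> // := jm_comm_on a.
  by apply: (subvP (symalg_onS C (ptsS ma))).
have pairGZ m : (m <= n)%N -> pair_sum m \in gelfand_zetlin C n.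
  case: m => [_|m mn].
    by rewrite /pair_sum big1 ?mem0v // => b; rewrite inE.
  apply: (subvP (sub_agenv _)).
  by apply: (subvP (sumv_sup (Ordinal mn) _ (subvv _))) (pair_sum_central _).
apply: jm_alg_sub => // a _; rewrite -[jm a](@scalerK _ _ 2%:R) ?pnatr_eq0 //.
rewrite memvZ // (_ : _ *: _ = pair_sum a.+1 - pair_sum a - 1).
  by rewrite !memvB // pairGZ // ltnW.
by rewrite jm_pair_sum addrAC addrK addrAC subrr add0r.
Qed.

End JucysMurphy.

(** * Limits of scalar sequences *)

Section ScalarLimits.
Variable K : numFieldType.
Implicit Types (u v : nat -> K) (l m : K).

Definition tends u l := (fun k => u k : K^o) @ \oo --> (l : K^o).

Lemma tends_cst l : tends (fun=> l) l. Proof. exact: cvg_cst. Qed.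

Lemma tendsD u v l m : tends u l -> tends v m ->
  tends (fun k => u k + v k) (l + m).
Proof. exact: cvgD. Qed.

Lemma tendsN u l : tends u l -> tends (fun k => - u k) (- l).
Proof. exact: cvgN. Qed.

Lemma tendsM u v l m : tends u l -> tends v m ->
  tends (fun k => u k * v k) (l * m).
Proof. exact: cvgM. Qed.

Lemma tendsV u l : l != 0 -> tends u l -> tends (fun k => (u k)^-1) l^-1.
Proof. by move=> l0; apply: (@cvgV K). Qed.

Lemma tends_eq u v l : tends u l -> (\forall k \near \oo, u k = v k) -> tends v l.
Proof.
move=> ul uv; apply: cvg_trans ul; apply: near_eq_cvg.
by apply: filterS uv => k ->.
Qed.

Lemma tends_neq0 u l : l != 0 -> tends u l -> \forall k \near \oo, u k != 0.
Proof. by move=> l0 ul; exact: (@cvgr_neq0 K K^o _ _ _ u l ul l0). Qed.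

Lemma tends_sum (I : Type) (r : seq I) (P : pred I) (u : nat -> I -> K) (l : I -> K) :
  (forall i, P i -> tends (u^~ i) (l i)) ->
  tends (fun k => \sum_(i <- r | P i) u k i) (\sum_(i <- r | P i) l i).
Proof.
move=> ul; elim: r => [|i r IH].
  by rewrite big_nil; apply: tends_eq (@tends_cst 0) _; near=> k; rewrite big_nil.
rewrite big_cons; case: (boolP (P i)) => Pi; last first.
  by apply: tends_eq IH _; near=> k; rewrite big_cons (negPf Pi).
by apply: tends_eq (tendsD (ul i Pi) IH) _; near=> k; rewrite big_cons Pi.
Unshelve. all: by end_near.
Qed.

Lemma tends_prod (I : Type) (r : seq I) (P : pred I) (u : nat -> I -> K) (l : I -> K) :
  (forall i, P i -> tends (u^~ i) (l i)) ->
  tends (fun k => \prod_(i <- r | P i) u k i) (\prod_(i <- r | P i) l i).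
Proof.
move=> ul; elim: r => [|i r IH].
  by rewrite big_nil; apply: tends_eq (@tends_cst 1) _; near=> k; rewrite big_nil.
rewrite big_cons; case: (boolP (P i)) => Pi; last first.
  by apply: tends_eq IH _; near=> k; rewrite big_cons (negPf Pi).
by apply: tends_eq (tendsM (ul i Pi) IH) _; near=> k; rewrite big_cons Pi.
Unshelve. all: by end_near.
Qed.

Lemma tends_det d (M : nat -> 'M[K]_d) (N : 'M[K]_d) :
  (forall i j, tends (fun k => M k i j) (N i j)) ->
  tends (fun k => \det (M k)) (\det N).
Proof.
move=> MN; rewrite /determinant; apply: tends_sum => s _.
by apply: tendsM; [exact: tends_cst|apply: tends_prod].
Qed.

End ScalarLimits.
Arguments tends_cst {K} l.
Arguments tends_eq {K u v l}.

(** * Limits of group algebra elements, coordinate by coordinate *)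

Section AlgebraLimits.
Variable K : numFieldType.

Definition tends_coord (T : finType) (x : nat -> {ffun T -> K^o}) (l : {ffun T -> K^o}) :=
  forall t, tends (fun k => x k t) (l t).

Variable n : nat.
Local Notation A := (symalg K n).
Implicit Types (x y : nat -> A) (l m : A).

Definition tends_alg x l := @tends_coord 'S_n x l.

Lemma tends_alg_cst l : tends_alg (fun=> l) l.
Proof. by move=> s; exact: tends_cst. Qed.

Lemma tends_algD x y l m : tends_alg x l -> tends_alg y m ->
  tends_alg (fun k => x k + y k) (l + m).
Proof.
move=> xl ym s; rewrite ffunE; apply: tends_eq (tendsD (xl s) (ym s)) _.
by near=> k; rewrite ffunE.
Unshelve. all: by end_near.
Qed.

Lemma tends_algZ (c : nat -> K) (d : K) x l : tends c d -> tends_alg x l ->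
  tends_alg (fun k => c k *: x k) (d *: l).
Proof.
move=> cd xl s; rewrite ffunE; apply: tends_eq (tendsM cd (xl s)) _.
by near=> k; rewrite ffunE.
Unshelve. all: by end_near.
Qed.

Lemma tends_algM x y l m : tends_alg x l -> tends_alg y m ->
  tends_alg (fun k => x k * y k) (l * m).
Proof.
move=> xl ym s; rewrite mul_coefE.
apply: (@tends_eq _ (fun k => \sum_g x k g * y k (s * g^-1)%g)).
  by apply: tends_sum => g _; apply: tendsM; [exact: xl|exact: ym].
by near=> k; rewrite mul_coefE.
Unshelve. all: by end_near.
Qed.

Lemma tends_alg_eq x y l : tends_alg x l -> (\forall k \near \oo, x k = y k) ->
  tends_alg y l.
Proof.
by move=> xl xy s; apply: tends_eq (xl s) _; apply: filterS xy => k ->.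
Qed.

Lemma tends_algB x y l m : tends_alg x l -> tends_alg y m ->
  tends_alg (fun k => x k - y k) (l - m).
Proof.
move=> xl ym; rewrite -scaleN1r.
apply: tends_alg_eq (tends_algD xl (tends_algZ (tends_cst (-1 : K)) ym)) _.
by near=> k; rewrite scaleN1r.
Unshelve. all: by end_near.
Qed.

(** The terms of degree at least two in the product are negligible, as [d] tends to
    [0] and each [e] is of the order of [d]. *)
Lemma tends_first_order (I : eqType) (t : I -> A) (e : nat -> I -> K)
    (c : I -> K) (d : nat -> K) (s : seq I) :
  (forall k, d k != 0) -> tends d 0 ->
  {in s, forall b, tends (fun k => e k b / d k) (c b)} ->
  tends_alg (fun k => (d k)^-1 *: (\prod_(b <- s) (1 + e k b *: t b) - 1))
    (\sum_(b <- s) c b *: t b).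
Proof.
move=> d0 d_0; elim: s => [_|b s IH ec].
  rewrite big_nil; apply: tends_alg_eq (@tends_alg_cst 0) _.
  by near=> k; rewrite big_nil subrr scaler0.
have {}IH : tends_alg (fun k => (d k)^-1 *: (\prod_(b <- s) (1 + e k b *: t b) - 1))
    (\sum_(b <- s) c b *: t b).
  have ec' : {in s, forall b', tends (fun k => e k b' / d k) (c b')}.
    by move=> b' b's; have /ec : b' \in b :: s by rewrite in_cons b's orbT.
  exact: IH ec'.
have P1 : tends_alg (fun k => \prod_(b <- s) (1 + e k b *: t b)) 1.
  rewrite -[X in tends_alg _ X]addr0 -(scale0r (\sum_(b <- s) c b *: t b)).
  apply: tends_alg_eq (tends_algD (@tends_alg_cst 1) (tends_algZ d_0 IH)) _.
  by near=> k; rewrite scalerA mulfV // scale1r addrC subrK.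
have tP := tends_algM (@tends_alg_cst (t b)) P1.
rewrite big_cons addrC -{1}[t b]mulr1.
apply: tends_alg_eq (tends_algD IH (tends_algZ (ec b (mem_head b s)) tP)) _.
near=> k; rewrite big_cons mulrDl mul1r -scalerAl.
rewrite [X in _ = _ *: X]addrAC [RHS]scalerDr [in RHS]scalerA.
by rewrite [(d k)^-1 * _]mulrC.
Unshelve. all: by end_near.
Qed.

End AlgebraLimits.

(** * The Hamiltonians in the limit *)

Section Gaps.
Variables (K : numFieldType) (N : nat) (hbar : nat -> K) (w : nat -> nat -> K).
Local Notation gap j := (fun k => w j k - w j.+1 k).
Hypothesis w_neq : forall k j, (j.+1 < N)%N -> w j k != w j.+1 k.
Hypothesis hbar_small : (1 < N)%N -> tends (fun k => hbar k / gap 0%N k) 0.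
Hypothesis gap_small : forall j, (j.+2 < N)%N ->
  tends (fun k => gap j k / gap j.+1 k) 0.

Lemma gap_neq0 j k : (j.+1 < N)%N -> gap j k != 0.
Proof. by move=> jN; rewrite subr_eq0 w_neq. Qed.

Lemma gap_ratio i j : (i < j)%N -> (j.+1 < N)%N ->
  tends (fun k => gap i k / gap j k) 0.
Proof.
elim: j => // j IH; rewrite ltnS leq_eqVlt => /orP[/eqP ->|ij] jN.
  exact: gap_small.
rewrite -(mulr0 0).
apply: tends_eq (tendsM (IH ij (ltnW jN)) (gap_small jN)) _.
by near=> k; rewrite mulrA divfK // gap_neq0 // ltnW.
Unshelve. all: by end_near.
Qed.

Lemma hbar_gap j : (j.+1 < N)%N -> tends (fun k => hbar k / gap j k) 0.
Proof.
case: j => [|j] jN; first exact: hbar_small.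
have N1 : (1 < N)%N by apply: leq_ltn_trans jN.
rewrite -(mulr0 0).
apply: tends_eq (tendsM (hbar_small N1) (gap_ratio (ltn0Sn j) jN)) _.
by near=> k; rewrite mulrA divfK // gap_neq0.
Unshelve. all: by end_near.
Qed.

(** The difference is a sum of consecutive gaps, all negligible with respect to the
    last one. *)
Lemma last_gap_dominates i j : (i <= j)%N -> (j.+1 < N)%N ->
  tends (fun k => (w i k - w j.+1 k) / gap j k) 1.
Proof.
move=> ij jN; rewrite -(subKn ij); elim: (j - i)%N (leq_subr i j) => [_|m IH mj].
  rewrite subn0; apply: tends_eq (@tends_cst K 1) _.
  by near=> k; rewrite mulfV // gap_neq0.
have jm : (j - m.+1).+1 = (j - m)%N by rewrite subnSK.
have jmj : (j - m.+1 < j)%N by rewrite jm leq_subr.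
rewrite -[1]add0r.
apply: tends_eq (tendsD (gap_ratio jmj jN) (IH (ltnW mj))) _.
by near=> k; rewrite jm -mulrDl addrA subrK.
Unshelve. all: by end_near.
Qed.

End Gaps.

Section HamiltonianLimit.
Variables (K : numFieldType) (n : nat) (hbar : nat -> K) (z : nat -> 'I_n -> K).
Hypothesis hbar_neq0 : forall k, hbar k != 0.
Hypothesis z_neq : forall k (a b : 'I_n), b = a.+1 :> nat -> z k a != z k b.
Hypothesis hbar_lim : forall a b : 'I_n, a = 0%N :> nat -> b = 1%N :> nat ->
  tends (fun k => hbar k / (z k a - z k b)) 0.
Hypothesis z_lim : forall a b c : 'I_n, b = a.+1 :> nat -> c = b.+1 :> nat ->
  tends (fun k => (z k a - z k b) / (z k b - z k c)) 0.

(** Indexing by natural numbers makes neighbouring sites easy to name; the value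
    from [n] on is a dummy. *)
Definition zn j k : K := if insub j is Some a then z k a else 0.

Lemma znE (a : 'I_n) k : zn a k = z k a.
Proof. by rewrite /zn valK. Qed.

Lemma zn_ord j (jn : (j < n)%N) k : zn j k = z k (Ordinal jn).
Proof. exact: (znE (Ordinal jn)). Qed.

Lemma zn_neq k j : (j.+1 < n)%N -> zn j k != zn j.+1 k.
Proof. by move=> jn; rewrite (zn_ord jn) (zn_ord (ltnW jn)); apply: z_neq. Qed.

Lemma zn_hbar : (1 < n)%N -> tends (fun k => hbar k / (zn 0 k - zn 1 k)) 0.
Proof.
move=> n1; apply: tends_eq (hbar_lim (a := Ordinal (ltnW n1)) (b := Ordinal n1) _ _) _ => //.
by near=> k; rewrite (zn_ord n1) (zn_ord (ltnW n1)).
Unshelve. all: by end_near.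
Qed.

Lemma zn_gap j : (j.+2 < n)%N ->
  tends (fun k => (zn j k - zn j.+1 k) / (zn j.+1 k - zn j.+2 k)) 0.
Proof.
move=> jn; have j1 := ltnW jn; have j0 := ltnW j1.
apply: tends_eq (z_lim (a := Ordinal j0) (b := Ordinal j1) (c := Ordinal jn) _ _) _ => //.
by near=> k; rewrite (zn_ord jn) (zn_ord j1) (zn_ord j0).
Unshelve. all: by end_near.
Qed.

Implicit Types a b : 'I_n.

(** The small parameter in which the Hamiltonian at a site [a > 0] is expanded. *)
Definition step_size a k : K := hbar k / (z k a - zn a.-1 k).

Lemma prev_gap a k : (0 < a)%N -> z k a - zn a.-1 k = - (zn a.-1 k - zn a.-1.+1 k).
Proof. by move=> a0; rewrite prednK // znE opprB. Qed.

Lemma step_size_neq0 a k : (0 < a)%N -> step_size a k != 0.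
Proof.
move=> a0; rewrite /step_size prev_gap // mulf_neq0 // invr_eq0 oppr_eq0.
by rewrite subr_eq0 zn_neq // prednK.
Qed.

Lemma step_size_lim a : (0 < a)%N -> tends (step_size a) 0.
Proof.
move=> a0; have aN : (a.-1.+1 < n)%N by rewrite prednK.
rewrite -oppr0.
apply: tends_eq (tendsN (hbar_gap zn_neq zn_hbar zn_gap aN)) _.
by near=> k; rewrite /step_size prev_gap // invrN mulrN.
Unshelve. all: by end_near.
Qed.

Lemma near_z_neq a b : a != b -> \forall k \near \oo, z k a - z k b != 0.
Proof.
wlog ab : a b / (a < b)%N.
  move=> W; rewrite neq_ltn => /orP[ab|ba]; first by apply: W; rewrite ?neq_ltn ?ab.
  have : \forall k \near \oo, z k b - z k a != 0 by apply: W; rewrite ?neq_ltn ?ba.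
  by apply: filterS => k; rewrite !subr_eq0 eq_sym.
move=> _; have b0 : (0 < b)%N by apply: leq_ltn_trans ab.
have bN : (b.-1.+1 < n)%N by rewrite prednK.
have ab' : (a <= b.-1)%N by rewrite -ltnS prednK.
have := tends_neq0 (oner_neq0 K) (last_gap_dominates zn_neq zn_gap ab' bN).
apply: filterS => k; rewrite prednK // !znE; apply: contraNneq => ->.
by rewrite mul0r.
Qed.

(** For [b < a] the difference [z a - z b] is equivalent to the gap just before [a];
    for [b > a] it is equivalent to the gap just before [b], which is much larger. *)
Lemma ratio_lim a b : (0 < a)%N -> a != b ->
  tends (fun k => hbar k / (z k a - z k b) / step_size a k) (b < a)%N%:R.
Proof.
move=> a0 ab; have aN : (a.-1.+1 < n)%N by rewrite prednK.
pose f k := (zn a.-1 k - zn a.-1.+1 k) / (z k b - z k a).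
suff : tends f (b < a)%N%:R.
  move=> flim; apply: tends_eq flim _; apply: filterS (near_z_neq ab) => k.
  rewrite /f /step_size prev_gap // -(opprB (z k a)).
  have : zn a.-1 k - zn a.-1.+1 k != 0 by apply: gap_neq0 aN; exact: zn_neq.
  move: (hbar_neq0 k); move: (hbar k) (_ - _) (z k a - z k b) => h G D h0 G0 D0.
  by field; rewrite h0 G0 D0.
have [ba|ab'] := ltnP b a.
  have ba' : (b <= a.-1)%N by rewrite -ltnS prednK.
  have := tendsV (oner_neq0 K) (last_gap_dominates zn_neq zn_gap ba' aN).
  rewrite invr1 => lim; apply: tends_eq lim _; near=> k.
  by rewrite invfM invrK mulrC /f prednK // !znE.
have {ab'} ab' : (a < b)%N by rewrite ltn_neqAle ab.
have b0 : (0 < b)%N by apply: leq_ltn_trans ab'.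
have bN : (b.-1.+1 < n)%N by rewrite prednK.
have ab1 : (a <= b.-1)%N by rewrite -ltnS prednK.
have ab2 : (a.-1 < b.-1)%N by rewrite prednK.
have lim1 := gap_ratio zn_neq zn_gap ab2 bN.
have lim2 := tendsV (oner_neq0 K) (last_gap_dominates zn_neq zn_gap ab1 bN).
rewrite (_ : false%:R = - (0 * 1^-1) :> K); last by rewrite mul0r oppr0.
apply: tends_eq (tendsN (tendsM lim1 lim2)) _.
apply: filterS (near_z_neq ab) => k; rewrite /f prednK // !znE => D0.
have : zn b.-1 k - zn b.-1.+1 k != 0 by apply: gap_neq0 bN; exact: zn_neq.
rewrite prednK // znE.
move: (zn a.-1 k - _) (zn b.-1 k - _) => G G' G'0.
rewrite -(opprB (z k a)); move: (_ - _) D0 => D D0.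
by field; rewrite G'0 D0.
Unshelve. all: by end_near.
Qed.

(** The first-order part of the normalized Hamiltonian.  The site [0] has no gap
    before it, and its Jucys-Murphy element is [0]. *)
Definition rescaled_ham a k : symalg K n :=
  if (a == 0 :> nat)%N then 0 else
  (step_size a k)^-1 *:
    ((\prod_(b <- sites_after a ++ sites_before a) (z k a - z k b))^-1 *:
      hamiltonian (hbar k) (z k) a - 1).

Lemma ham_normalize (h : K) (y : 'I_n -> K) s a :
  {in s, forall b, y a - y b != 0} ->
  ham h y s a = (\prod_(b <- s) (y a - y b)) *:
    \prod_(b <- s) (1 + (h / (y a - y b)) *: symb K (tperm b a)).
Proof.
rewrite /ham; elim: s => [_|b s IH ys]; first by rewrite !big_nil scale1r.
rewrite !big_cons IH => [|c cs]; last by apply: ys; rewrite in_cons cs orbT.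
have yb : y a - y b != 0 by apply: ys; rewrite mem_head.
have -> : rmat h y b a =
    (y a - y b) *: (1 + (h / (y a - y b)) *: symb K (tperm b a)).
  by rewrite scalerDr scalerA mulrCA mulfV // mulr1.
by rewrite -scalerAl -scalerAr scalerA.
Qed.

Lemma other_sites a b : (b \in sites_after a ++ sites_before a) = (b != a).
Proof.
have := uniq_site_split a; have := mem_site_seq b; rewrite (site_seqE a).
rewrite !mem_cat in_cons cat_uniq /=; case: (eqVneq b a) => [->|_ /=].
  by move=> _ /and3P[_ /norP[/negPf -> _] /andP[/negPf ->]].
by rewrite orbC => ->.
Qed.

Lemma uniq_other_sites a : uniq (sites_after a ++ sites_before a).
Proof.
have := uniq_site_split a; rewrite !cat_uniq /=.
move=> /and3P[-> /norP[_ h] /andP[_ ->]]; rewrite andbT has_sym.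
by rewrite h.
Qed.

Lemma rescaled_ham_lim a : tends_alg (rescaled_ham a) (jucys_murphy K a).
Proof.
rewrite /rescaled_ham; case: (posnP a) => [a0|a_gt0].
  rewrite /jucys_murphy big1 => [|b]; last by rewrite a0.
  exact: tends_alg_cst.
set s := sites_after a ++ sites_before a.
have -> : jucys_murphy K a = \sum_(b <- s) (b < a)%N%:R *: symb K (tperm b a).
  rewrite [RHS]big_uniq ?uniq_other_sites // /jucys_murphy big_mkcond [RHS]big_mkcond /=.
  apply: eq_bigr => b _; rewrite other_sites neq_ltn.
  by case: ltnP => // _; rewrite ?scale1r // scale0r if_same.
have lim b : b \in s ->
    tends (fun k => hbar k / (z k a - z k b) / step_size a k) (b < a)%N%:R.
  by rewrite other_sites eq_sym => ab; apply: ratio_lim.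
have := tends_first_order (t := fun b => symb K (tperm b a))
  (e := fun k b => hbar k / (z k a - z k b))
  (fun k => step_size_neq0 k a_gt0) (step_size_lim a_gt0) lim.
move=> first_order; apply: tends_alg_eq first_order _.
have : \forall k \near \oo, forall b, b != a -> z k a - z k b != 0.
  apply: filter_forall => b; case: (eqVneq b a) => [_|ba]; first exact: nearW.
  by have := near_z_neq (a := a) (b := b); rewrite eq_sym => /(_ ba); apply: filterS => k.
apply: filterS => k zk; congr (_ *: (_ - 1)).
rewrite /hamiltonian.
have -> : ham (hbar k) (z k) (sites_after a) a * ham (hbar k) (z k) (sites_before a) a
    = ham (hbar k) (z k) s a by rewrite /ham big_cat.
rewrite ham_normalize => [|b]; last by rewrite other_sites; apply: zk.
rewrite scalerA mulVf ?scale1r // prodf_seq_neq0.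
by apply/allP => b; rewrite other_sites => /zk.
Qed.

End HamiltonianLimit.

(** * Openness of linear independence and convergence of spans *)

Section FreeNear.
Variables (K : numFieldType) (V : vectType K).

Lemma family_mktuple r (w : 'I_r -> V) :
  [seq w i | i <- enum 'I_r] = mktuple w.
Proof. by rewrite /= /image_mem enumT. Qed.

Lemma free_familyP r (w : 'I_r -> V) :
  reflect (forall c : 'I_r -> K, \sum_i c i *: w i = 0 -> forall i, c i = 0)
    (free [seq w i | i <- enum 'I_r]).
Proof.
pose X : r.-tuple V := mktuple w.
have XE (c : 'I_r -> K) : \sum_i c i *: X`_i = \sum_i c i *: w i.
  by apply: eq_bigr => i _; rewrite -tnth_nth tnth_mktuple.
rewrite family_mktuple.
by apply: (iffP freeP) => h c; [rewrite -XE|rewrite XE]; apply: h.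
Qed.

(** Linear independence of [w] is witnessed by its dual functionals, through a
    determinant that stays away from [0]. *)
Lemma free_near r (w : 'I_r -> V) (v : nat -> 'I_r -> V) :
  free [seq w i | i <- enum 'I_r] ->
  (forall (f : {scalar V}) i, tends (fun k => f (v k i)) (f (w i))) ->
  \forall k \near \oo, free [seq v k i | i <- enum 'I_r].
Proof.
pose X : r.-tuple V := mktuple w.
move=> freew vw; have freeX : free X by rewrite -family_mktuple.
pose M k := \matrix_(i < r, j < r) coord X j (v k i).
have wE i j : coord X j (w i) = (1%:M : 'M[K]_r) i j.
  by rewrite mxE -(coord_free i j freeX) -tnth_nth tnth_mktuple.
have : tends (fun k => \det (M k)) (\det (1%:M : 'M[K]_r)).
  apply: tends_det => i j; rewrite -wE.
  apply: tends_eq (vw (coord X j : {scalar V}) i) _.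
  by near=> k; rewrite mxE.
rewrite det1 => /(tends_neq0 (oner_neq0 K)); apply: filterS => k det_neq0.
apply/free_familyP => c c0 i.
have cM : (\row_j c j) *m M k = 0.
  apply/rowP => j; rewrite !mxE -[RHS](linear0 (coord X j)) -c0 linear_sum.
  by apply: eq_bigr => l _; rewrite !mxE linearZ.
have Mu : M k \in unitmx by rewrite unitmxE unitfE.
have := congr1 (fun u => u *m invmx (M k)) cM; rewrite mulmxK // mul0mx.
by move/rowP/(_ i); rewrite !mxE.
Unshelve. all: by end_near.
Qed.

Definition coord_mx r (u : 'I_r -> V) : 'M[K]_(r, \dim {:V}) :=
  \matrix_(i, j) coord (vbasis {:V}) j (u i).

Lemma row_coord_mx r (u : 'I_r -> V) i :
  row i (coord_mx u) = passmx.rVof (vbasis {:V}) (u i).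
Proof. by apply/rowP => j; rewrite !mxE. Qed.

Lemma row_span_coord_mx r (u : 'I_r -> V) :
  row_span (coord_mx u) = <<[seq u i | i <- enum 'I_r]>>%VS.
Proof.
congr (<<_>>)%VS; apply: eq_map => i.
by rewrite row_coord_mx passmx.rVofK // vbasisP.
Qed.

Lemma row_free_coord_mx r (u : 'I_r -> V) :
  free [seq u i | i <- enum 'I_r] -> row_free (coord_mx u).
Proof.
move=> /free_familyP freeu; apply: inj_row_free => c c0; apply/rowP => i.
rewrite mxE; apply: (freeu (fun i => c 0 i)); apply/eqP.
rewrite -(passmx.rVof_eq0 (vbasisP {:V})); apply/eqP; rewrite -[RHS]c0; apply/rowP => j; rewrite !mxE linear_sum.
by apply: eq_bigr => k _; rewrite linearZ mxE.
Qed.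

(** The topology of the Grassmannian is a quotient of that of frames, and the
    coordinates of a frame are linear functionals of its vectors. *)
Lemma grassmannian_cvg r (W : nat -> {vspace V}) (W0 : {vspace V})
    (v : nat -> 'I_r -> V) (w : 'I_r -> V) :
  free [seq w i | i <- enum 'I_r] -> <<[seq w i | i <- enum 'I_r]>>%VS = W0 ->
  (\forall k \near \oo, free [seq v k i | i <- enum 'I_r]) ->
  (\forall k \near \oo, <<[seq v k i | i <- enum 'I_r]>>%VS = W k) ->
  (forall (f : {scalar V}) i, tends (fun k => f (v k i)) (f (w i))) ->
  (fun k => W k : grassmannian V) @ \oo --> (W0 : grassmannian V).
Proof.
move=> freew spanw freev spanv vw A [B [Bop BW0 BA]].
have /open_subspaceP[Q Qop QE] := Bop r.
have Qw : Q (coord_mx w).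
  suff : (Q `&` @frames K V r) (coord_mx w) by case.
  rewrite QE; split; last exact: row_free_coord_mx.
  by rewrite /= row_span_coord_mx spanw.
have [P Pw PQ] : nbhs (coord_mx w) Q by apply: open_nbhs_nbhs.
have Pv : \forall k \near \oo, forall i j, P i j (coord_mx (v k) i j).
  apply: filter_forall => i; apply: filter_forall => j.
  have lim : tends (fun k => coord_mx (v k) i j) (coord_mx w i j).
    rewrite mxE; apply: tends_eq (vw (coord (vbasis {:V}) j : {scalar V}) i) _.
    by near=> k; rewrite mxE.
  exact: (lim (P i j) (Pw i j)).
suff : \forall k \near \oo, A (W k) by [].
apply: filterS3 Pv freev spanv => k Pk freek spank; apply: BA.
have : (Q `&` @frames K V r) (coord_mx (v k)).
  by split; [apply: PQ|apply: row_free_coord_mx].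
by rewrite QE => -[/= + _]; rewrite row_span_coord_mx spank.
Unshelve. all: by end_near.
Qed.

End FreeNear.

Lemma scalar_tends_ffun (K : numFieldType) (T : finType)
    (x : nat -> {ffun T -> K^o}) l (f : {scalar {ffun T -> K^o}}) :
  tends_coord x l -> tends (fun k => f (x k)) (f l).
Proof.
move=> xl; pose d t : {ffun T -> K^o} := [ffun t' => (t' == t)%:R].
have fE u : f u = \sum_t u t * f (d t).
  have uE : u = \sum_t u t *: d t.
    apply/ffunP => t; rewrite sum_ffunE (bigD1 t) //= big1 => [|t' tt'].
      by rewrite !ffunE eqxx addr0 /GRing.scale/= mulr1.
    by rewrite !ffunE eq_sym (negPf tt') scaler0.
  by rewrite {1}uE linear_sum; apply: eq_bigr => t _; rewrite linearZ.
rewrite fE; apply: (@tends_eq _ (fun k => \sum_t x k t * f (d t))).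
  by apply: tends_sum => t _; apply: tendsM; [exact: xl|exact: tends_cst].
by near=> k; rewrite fE.
Unshelve. all: by end_near.
Qed.

Lemma scalar_tends_alg (K : numFieldType) n (x : nat -> symalg K n) l
    (f : {scalar symalg K n}) :
  tends_alg x l -> tends (fun k => f (x k)) (f l).
Proof.
move=> xl; have fE u : f u = \sum_s u s * f (symb K s).
  by rewrite {1}(symalg_sum u) linear_sum; apply: eq_bigr => s _; rewrite linearZ.
rewrite fE; apply: (@tends_eq _ (fun k => \sum_s x k s * f (symb K s))).
  by apply: tends_sum => t _; apply: tendsM; [exact: xl|exact: tends_cst].
by near=> k; rewrite fE.
Unshelve. all: by end_near.
Qed.

(** * The limit of the Bethe subalgebras *)

Section BetheLimit.
Variables (K : numClosedFieldType) (n : nat) (p : K).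
Variables (hbar : nat -> K) (z : nat -> 'I_n -> K).
Hypothesis hbar_neq0 : forall k, hbar k != 0.
Hypothesis z_neq : forall k (a b : 'I_n), b = a.+1 :> nat -> z k a != z k b.
Hypothesis hbar_lim : forall a b : 'I_n, a = 0%N :> nat -> b = 1%N :> nat ->
  tends (fun k => hbar k / (z k a - z k b)) 0.
Hypothesis z_lim : forall a b c : 'I_n, b = a.+1 :> nat -> c = b.+1 :> nat ->
  tends (fun k => (z k a - z k b) / (z k b - z k c)) 0.

Local Notation A := (symalg K n).
Local Notation B k := (bethe_alg p (hbar k) (z k)).
Local Notation H a k := (rescaled_ham hbar z a k).
Local Notation GZ := (gelfand_zetlin K n).

Lemma bethe_alg1 k : 1 \in B k.
Proof. by rewrite (subvP (sub1_agenv _)) // memv_line. Qed.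

Lemma rescaled_ham_in a k : H a k \in B k.
Proof.
rewrite /rescaled_ham; case: posnP => [_|a0]; first exact: mem0v.
rewrite memvZ // memvB ?bethe_alg1 // memvZ // hamiltonian_in //.
exact: leq_ltn_trans a0 (ltn_ord a).
Qed.

Lemma rescaled_ham_comm a k : (B k <= 'C[H a k])%VS.
Proof.
apply/subvP => x xB; apply/cent1vP; rewrite /rescaled_ham.
case: posnP => [_|a0]; first by rewrite mulr0 mul0r.
rewrite -scalerAl -scalerAr mulrBl mulrBr mul1r mulr1 -scalerAl -scalerAr.
by rewrite (bethe_alg_comm a xB).
Qed.

(** Limits of elements of the Bethe subalgebras form an algebra, and it contains the
    Jucys-Murphy elements. *)
Lemma approximable : {in GZ, forall x, exists2 y : nat -> A,
  forall k, y k \in B k & tends_alg y x}.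
Proof.
rewrite gelfand_zetlin_jm; apply: agenv_ind => [x y|c x|x y||x].
- move=> [u uB ux] [v vB vy]; exists (fun k => u k + v k).
    by move=> k; rewrite memvD.
  exact: tends_algD.
- move=> [u uB ux]; exists (fun k => c *: u k); first by move=> k; rewrite memvZ.
  by apply: tends_algZ => //; exact: tends_cst.
- move=> [u uB ux] [v vB vy]; exists (fun k => u k * v k).
    by move=> k; apply: memvM.
  exact: tends_algM.
- by exists (fun=> 1); [exact: bethe_alg1|exact: tends_alg_cst].
case/mapP => a _ ->; exists (rescaled_ham hbar z a).
  exact: rescaled_ham_in.
exact: rescaled_ham_lim.
Qed.

(** The kernel of this map is the commutant of the [x a]; as a single linear map
    depending on [x], it lets the dimension of the commutant be compared for
    nearby [x]. *)
Definition bracket_fun (x : 'I_n -> A) (y : A) : {ffun 'I_n * 'S_n -> K^o} :=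
  [ffun q => (x q.1 * y - y * x q.1) q.2].

Lemma bracket_fun_is_linear x : linear (bracket_fun x).
Proof.
move=> c y1 y2; apply/ffunP => q; rewrite !ffunE mulrDl mulrDr -scalerAl -scalerAr.
rewrite !ffunE; rewrite scalerBr opprD addrACA.
by [].
Qed.
HB.instance Definition _ x :=
  GRing.isLinear.Build K A {ffun 'I_n * 'S_n -> K^o} _ (bracket_fun x)
    (bracket_fun_is_linear x).

Definition bracket x := linfun (bracket_fun x).

Lemma mem_bracket_ker x y :
  (y \in lker (bracket x)) = [forall a, x a * y == y * x a].
Proof.
rewrite memv_ker lfunE /=; apply/eqP/forallP => [y0 a|y0].
  rewrite -subr_eq0; apply/eqP/ffunP => s.
  by move/ffunP/(_ (a, s)): y0; rewrite !ffunE.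
apply/ffunP => q; rewrite !ffunE.
by move: (y0 q.1) => /eqP ->; rewrite subrr.
Qed.

Lemma bracket_ker_jm : lker (bracket (@jucys_murphy K n)) = GZ :> {vspace A}.
Proof.
rewrite gelfand_zetlin_jm; apply/eqP; rewrite eqEsubv; apply/andP; split.
  apply: subv_trans (centraliser_jm K n); apply/subvP => y.
  rewrite mem_bracket_ker => /forallP y0.
  rewrite -subv_cent1; apply: (@jm_alg_sub _ _ n [aspace of 'C[y]]) => [|a _].
    exact: cent1v1.
  exact/cent1vP/eqP.
apply/subvP => y yJ; rewrite mem_bracket_ker; apply/forallP => a; apply/eqP.
have /subvP/(_ y yJ)/centvP -> // := jm_alg_comm K n n.
exact: jm_in.
Qed.

Lemma bethe_sub_bracket_ker k :
  (B k <= lker (bracket (fun a => H a k)))%VS.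
Proof.
apply/subvP => y yB; rewrite mem_bracket_ker; apply/forallP => a; apply/eqP.
by have /subvP/(_ y yB)/cent1vP -> := rescaled_ham_comm a k.
Qed.

(** The images of a basis of a complement of the kernel are independent in the
    limit, hence independent nearby: the rank of the commutator map cannot drop,
    and the dimension of its kernel cannot jump up. *)
Lemma near_dim_le : \forall k \near \oo, (\dim (B k) <= \dim GZ)%N.
Proof.
set phi := bracket (@jucys_murphy K n); pose phik k := bracket (fun a => H a k).
set U := (lker phi)^C%VS.
pose w (i : 'I_(\dim U)) := phi (vbasis U)`_i.
pose v k (i : 'I_(\dim U)) := phik k (vbasis U)`_i.
have freew : free [seq w i | i <- enum 'I_(\dim U)].
  apply/free_familyP => c c0 i; pose y := \sum_i c i *: (vbasis U)`_i.
  have phi_y : phi y = 0.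
    by rewrite /y linear_sum -[RHS]c0; apply: eq_bigr => j _; rewrite linearZ.
  have yU : y \in U.
    by apply: memv_suml => j _; rewrite memvZ // vbasis_mem // mem_nth // size_tuple.
  have y0 : y = 0.
    by apply/eqP; rewrite -memv0 -(capv_compl (lker phi)) memv_cap memv_ker phi_y eqxx.
  by move/freeP: (basis_free (vbasisP U)) => /(_ c y0 i).
have vw (f : {scalar {ffun 'I_n * 'S_n -> K^o}}) i :
    tends (fun k => f (v k i)) (f (w i)).
  apply: scalar_tends_ffun => q; rewrite /v /w /phik /phi.
  have lim : tends_alg (rescaled_ham hbar z q.1) (jucys_murphy K q.1).
    exact: rescaled_ham_lim.
  have cst := @tends_alg_cst K n (vbasis U)`_i.
  have lim_comm : tends_alg
      (fun k => H q.1 k * (vbasis U)`_i - (vbasis U)`_i * H q.1 k)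
      (jucys_murphy K q.1 * (vbasis U)`_i - (vbasis U)`_i * jucys_murphy K q.1).
    by apply: tends_algB; apply: tends_algM.
  rewrite lfunE /= ffunE; apply: tends_eq (lim_comm q.2) _.
  by near=> k; rewrite [in RHS]lfunE /= [RHS]ffunE.
have := free_near freew vw; apply: filterS => k freev.
apply: leq_trans (dimvS (bethe_sub_bracket_ker k)) _; rewrite -bracket_ker_jm -/phi.
have le_r : (\dim U <= \dim (limg (phik k)))%N.
  move: freev; rewrite /free size_map size_enum_ord => /eqP <-; apply: dimvS.
  by apply/span_subvP => _ /mapP[i _ ->]; rewrite memv_img // memvf.
have := limg_ker_dim (phik k) {:A}%VS; rewrite capfv => dimk.
have := dimv_compl (lker phi); rewrite -/U => dimU.
rewrite -(leq_add2r (\dim U)).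
apply: (@leq_trans (\dim (lker (phik k)) + \dim (limg (phik k)))%N).
  by rewrite leq_add2l.
rewrite dimk dimU subnKC // dimvS // subvf.
Unshelve. all: by end_near.
Qed.

(** A basis of the Gelfand-Zetlin algebra is the limit of families in the Bethe
    subalgebras; these families are eventually independent, and [near_dim_le] makes
    them bases. *)
Lemma bethe_limit :
  (\forall k \near \oo, \dim (B k) = \dim GZ) /\
  ((fun k => B k : grassmannian A) @ \oo --> (GZ : grassmannian A)).
Proof.
pose d := \dim GZ; pose w (i : 'I_d) := (vbasis GZ)`_i.
have wGZ i : w i \in GZ by rewrite vbasis_mem // mem_nth // size_tuple.
have wE : [seq w i | i <- enum 'I_d] = vbasis GZ.
  rewrite family_mktuple; congr tval; apply: eq_from_tnth => i.
  by rewrite tnth_mktuple (tnth_nth 0).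
have freew : free [seq w i | i <- enum 'I_d] by rewrite wE (basis_free (vbasisP GZ)).
have /choice[v vP] i : exists y : nat -> A,
    (forall k, y k \in B k) /\ tends_alg y (w i).
  by have [y yB yw] := approximable (wGZ i); exists y.
have vw (f : {scalar A}) i : tends (fun k => f (v i k)) (f (w i)).
  by apply: scalar_tends_alg; case: (vP i).
have freev := free_near freew (v := fun k i => v i k) vw.
have span_le k : (<<[seq v i k | i <- enum 'I_d]>> <= B k)%VS.
  by apply/span_subvP => _ /mapP[i _ ->]; case: (vP i).
have span_dim k : free [seq v i k | i <- enum 'I_d] ->
    \dim <<[seq v i k | i <- enum 'I_d]>> = d.
  by move=> /eqnP ->; rewrite size_map size_enum_ord.
have dim_eq : \forall k \near \oo, \dim (B k) = d.
  apply: filterS2 near_dim_le freev => k le_d freek; apply/eqP.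
  by rewrite eqn_leq le_d -(span_dim k freek) dimvS.
split=> //; apply: (grassmannian_cvg freew _ freev _ vw).
  by rewrite wE (span_basis (vbasisP GZ)).
apply: filterS2 dim_eq freev => k dimk freek; apply/eqP.
by rewrite eqEdim span_le dimk span_dim /=.
Qed.

End BetheLimit.

Theorem proposition6p20 (R : realType) (n : nat) (n_gt0 : (0 < n)%N) (p : R[i])
    (hbar : nat -> R[i]) (z : nat -> 'I_n -> R[i])
    (hbar_neq0 : forall k, hbar k != 0)
    (z_neq : forall k (a b : 'I_n), b = a.+1 :> nat -> z k a != z k b)
    (hbar_lim : forall a b : 'I_n, a = 0%N :> nat -> b = 1%N :> nat ->
       (fun k => hbar k / (z k a - z k b) : R[i]^o) @ \oo --> (0 : R[i]^o))
    (z_lim : forall a b c : 'I_n, b = a.+1 :> nat -> c = b.+1 :> nat ->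
       (fun k => (z k a - z k b) / (z k b - z k c) : R[i]^o) @ \oo --> (0 : R[i]^o)) :
  (\forall k \near \oo,
     \dim (bethe_alg p (hbar k) (z k)) = \dim (gelfand_zetlin R[i] n)) /\
  ((fun k => bethe_alg p (hbar k) (z k) : grassmannian (symalg R[i] n)) @ \oo
     --> (gelfand_zetlin R[i] n : grassmannian (symalg R[i] n))).
Proof. exact: bethe_limit. Qed.
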